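(* Let $\Gamma$ be a countable hyperbolic group without torsion and let $\Lambda$ be an infinite quasi-isometrically embedded subgroup of $\Gamma$ with infinite index. Then the action of $\Gamma$ on $\partial_\beta(\Gamma/\Lambda)$, induced by left translation on $\Gamma/\Lambda$, is topologically amenable. In particular, if $\Lambda$ is a finitely generated subgroup of a free group $\mathbb{F}_r$, $r \geq 2$, and $\Lambda$ has infinite index in $\mathbb{F}_r$, then the action of $\mathbb{F}_r$ on $\partial_\beta(\mathbb{F}_r/\Lambda)$ is topologically amenable.
   Context: For a countable (discrete) set $\mathfrak{X}$, $\partial_\beta \mathfrak{X} = \beta\mathfrak{X} \setminus \mathfrak{X}$ denotes the Stone–Čech boundary (remainder) of $\mathfrak{X}$; an action of a group on $\mathfrak{X}$ extends to $\beta\mathfrak{X}$ and restricts to $\partial_\beta \mathfrak{X}$. Topological amenability: let a discrete countable group $\Gamma$ act by homeomorphisms on a compact Hausdorff space $X$. Let $\mathcal{P}(\Gamma)$ be the set of probability measures on $\Gamma$ (with the topology of pointwise convergence, equivalently the $\ell^1$-norm topology), with $\Gamma$ acting by left translation. The action on $X$ is topologically amenable if there is a net of continuous maps $\mu_i : X \to \mathcal{P}(\Gamma)$ such that $\lim_i \sup_{x \in X} \|\mu_i(\gamma x) - \gamma \mu_i(x)\|_1 = 0$ for every $\gamma \in \Gamma$. Hyperbolic means Gromov-hyperbolic. A subgroup $\Lambda$ is quasi-isometrically embedded if it is finitely generated and the inclusion $\Lambda \hookrightarrow \Gamma$ is a quasi-isometric embedding for word metrics associated to finite generating sets. $\mathbb{F}_r$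 is the free group of (finite) rank $r$. *)

(* Defs.v *)
From HB Require Import structures.
From mathcomp Require Import all_boot all_order all_algebra.
From mathcomp Require Import all_classical all_reals all_analysis.
Import numFieldNormedType.Exports.
Set Implicit Arguments.
Unset Strict Implicit.
Unset Printing Implicit Defensive.
Import Order.TTheory GRing.Theory Num.Theory.
Local Open Scope classical_set_scope.
Local Open Scope ring_scope.

Section WordMetric.
Context {G : groupType}.
Implicit Types (S w : seq G) (g h : G) (A : set G).

Definition word_over S w : bool := all (fun x => (x \in S) || (x^-1 \in S)%g) w.

Definition word_value w : G := (\prod_(x <- w) x)%g.

(* [A] is exactly the subgroup generated by the finite family [S]. *)
Definition generates S A : Prop :=
  A = [set g | exists2 w, word_over S w & word_value w = g].

Definition finitely_generated A : Prop := exists S, generates S A.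

Definition has_word_of_size S g (n : nat) : Prop :=
  exists w, [/\ word_over S w, size w = n & word_value w = g].

(* Junk value 0 outside the subgroup generated by [S]. *)
Definition word_length S g : nat :=
  match pselect (exists n, `[< has_word_of_size S g n >]) with
  | left Sg => ex_minn Sg
  | right _ => 0%N
  end.

Definition word_dist (R : realType) S g h : R := (word_length S (g^-1 * h)%g)%:R.

Definition torsion_free : Prop :=
  forall (g : G) (n : nat), (0 < n)%N -> (g ^+ n)%g = 1%g -> g = 1%g.

End WordMetric.
Arguments torsion_free G : clear implicits.

Section CoarseGeometry.
Context {R : realType}.

Definition gromov_product {X : Type} (d : X -> X -> R) (o x y : X) : R :=
  (d x o + d y o - d x y) / 2.

Definition gromov_hyperbolic {X : Type} (d : X -> X -> R) : Prop :=
  exists2 delta : R, 0 <= delta & forall o x y z : X,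
    Num.min (gromov_product d o x y) (gromov_product d o y z) - delta
      <= gromov_product d o x z.

Definition quasi_isometric_embedding {X Y : Type} (A : set X)
    (dX : X -> X -> R) (dY : Y -> Y -> R) (f : X -> Y) : Prop :=
  exists K C : R, [/\ 1 <= K, 0 <= C & forall x x', A x -> A x' ->
    K^-1 * dX x x' - C <= dY (f x) (f x') <= K * dX x x' + C].

End CoarseGeometry.

Definition hyperbolic_group (R : realType) (G : groupType) : Prop :=
  exists2 S : seq G, generates S [set: G] & gromov_hyperbolic (word_dist R S).

Definition qi_embedded_subgroup (R : realType) (G : groupType)
    (L : groupClosed G) : Prop :=
  exists S T : seq G, [/\ generates S [set` L], generates T [set: G] &
    quasi_isometric_embedding [set` L] (word_dist R S) (word_dist R T) id].

Section Cosets.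
Context {G : groupType} (L : groupClosed G).

Definition lcoset_rel : rel G := fun x y => (x^-1 * y)%g \in L.

Lemma lcoset_rel_refl : reflexive lcoset_rel.
Proof. by move=> x; rewrite /lcoset_rel mulVg gpred1. Qed.

Lemma lcoset_rel_sym : symmetric lcoset_rel.
Proof. by move=> x y; rewrite /lcoset_rel -gpredV invgM invgK. Qed.

Lemma lcoset_rel_trans : transitive lcoset_rel.
Proof.
move=> y x z xy yz; rewrite /lcoset_rel.
by rewrite -(mulgK y x^-1%g) -mulgA gpredM.
Qed.

Canonical lcoset_equiv :=
  EquivRel lcoset_rel lcoset_rel_refl lcoset_rel_sym lcoset_rel_trans.

Definition lcosets_of := {eq_quot lcoset_equiv}%qT.
HB.instance Definition _ := Choice.on lcosets_of.

Definition lcoset_of (x : G) : lcosets_of := (\pi_({eq_quot lcoset_equiv}) x)%qT.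

Definition lcoset_act (g : G) (u : lcosets_of) : lcosets_of :=
  lcoset_of (g * repr (u : {eq_quot lcoset_equiv}%qT))%g.

Lemma lcoset_ofP x y : lcoset_of x = lcoset_of y <-> (x^-1 * y)%g \in L.
Proof. by split=> [/eqquotP//|xy]; apply/eqquotP. Qed.

Lemma lcoset_of_surj u : exists x, u = lcoset_of x.
Proof. by exists (repr (u : {eq_quot lcoset_equiv}%qT)); rewrite /lcoset_of reprK. Qed.

Lemma lcoset_actE g x : lcoset_act g (lcoset_of x) = lcoset_of (g * x)%g.
Proof.
apply/lcoset_ofP; rewrite invgM mulgA mulgVK.
by apply/lcoset_ofP; rewrite /lcoset_of reprK.
Qed.

Lemma lcoset_act1 u : lcoset_act 1%g u = u.
Proof. by have [x ->] := lcoset_of_surj u; rewrite lcoset_actE mul1g. Qed.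

Lemma lcoset_actM g h u :
  lcoset_act (g * h)%g u = lcoset_act g (lcoset_act h u).
Proof. by have [x ->] := lcoset_of_surj u; rewrite !lcoset_actE mulgA. Qed.

End Cosets.

(* The Stone-Cech compactification of the discrete space [T]: the points are
   the ultrafilters on [T]; the sets of ultrafilters containing a given
   [A : set T] form a base of the topology.  [T] embeds as the principal
   ultrafilters, and [stone_cech_universal] is the universal property. *)

Section StoneCech.
Variable T : Type.

Record stone_cech := StoneCech {
  sc_filter :> set_system T ;
  sc_ultra : UltraFilter sc_filter }.

#[export] Existing Instance sc_ultra.

HB.instance Definition _ := gen_eqMixin stone_cech.
HB.instance Definition _ := gen_choiceMixin stone_cech.

Lemma stone_cech_inj (u v : stone_cech) : (u : set_system T) = v -> u = v.
Proof.
case: u v => [F FU] [G GU] /= FG; move: FU GU; rewrite FG => FU GU.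
by congr StoneCech; exact: Prop_irrelevance.
Qed.

Definition sc_basic (A : set T) : set stone_cech := [set u | (u : set_system T) A].

Lemma sc_basic_cover : \bigcup_(A in [set: set T]) sc_basic A = setT.
Proof.
by rewrite predeqE => u; split=> // _; exists setT => //; exact: filterT.
Qed.

Lemma sc_basic_join (A B : set T) u :
  [set: set T] A -> [set: set T] B -> sc_basic A u -> sc_basic B u ->
  exists C, [/\ [set: set T] C, sc_basic C u & sc_basic C `<=` sc_basic A `&` sc_basic B].
Proof.
move=> _ _ uA uB; exists (A `&` B); split=> //; first exact: filterI.
by rewrite /sc_basic => v /= vAB; split; apply: filterS vAB => ? [].
Qed.

HB.instance Definition _ :=
  isBaseTopological.Build stone_cech sc_basic_cover sc_basic_join.

Definition sc_embed (x : T) : stone_cech :=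
  StoneCech (principal_filter_ultra x).

Definition stone_cech_boundary : set stone_cech := ~` range sc_embed.

Lemma sc_basic_open A : open (sc_basic A).
Proof. by exists [set A] => //; rewrite bigcup_set1. Qed.

Lemma sc_basicC A : sc_basic (~` A) = ~` sc_basic A.
Proof.
rewrite predeqE => u; split=> [uAC uA|nuA].
  by have [x []] := filter_ex (filterI (uA : sc_filter u A) uAC).
by have [/nuA|] := in_ultra_setVsetC A (sc_ultra u).
Qed.

Lemma sc_nbhsP (u : stone_cech) (W : set stone_cech) :
  nbhs u W <-> exists2 A, (u : set_system T) A & sc_basic A `<=` W.
Proof.
split=> [|[A uA AW]]; last first.
  apply: filterS AW _; apply: open_nbhs_nbhs; split=> //.
  exact: sc_basic_open.
rewrite nbhsE => -[_ [[D _ <-] [A DA uA]] DW]; exists A => //.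
by move=> v vA; apply: DW; exists A.
Qed.

Lemma stone_cech_compact : compact [set: stone_cech].
Proof.
rewrite compact_ultra => F FU _.
pose u := [set A | F (sc_basic A)].
have uF : Filter u.
  split; rewrite /u /=.
  - by apply: filterS (@filterT _ F _) => v _; exact: (@filterT _ v _).
  - move=> A B FA FB.
    apply: filterS (@filterI _ F _ _ _ FA FB) => v [vA vB].
    exact: (@filterI _ v _ _ _ vA vB).
  - by move=> A B AB; apply: filterS => v; exact: (@filterS _ v).
have uP : ProperFilter u.
  split=> // u0.
  have [v v0] := filter_ex (u0 : F (sc_basic set0)).
  by have [] := filter_ex (v0 : sc_filter v set0).
have uU : UltraFilter u.
  split=> // H HP uH; rewrite eqEsubset; split=> // A HA.
  have [//|] := in_ultra_setVsetC (sc_basic A) FU.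
  rewrite -sc_basicC => /uH HAC.
  by have [x []] := filter_ex (filterI HA HAC).
exists (StoneCech uU); split=> // W /sc_nbhsP[A uA AW].
exact: filterS AW uA.
Qed.

Lemma stone_cech_hausdorff : hausdorff_space stone_cech.
Proof.
move=> u v uv; apply: stone_cech_inj.
apply: (@max_filter _ v (sc_ultra v) u) => A vA.
apply: contrapT => nuA.
have uAC : sc_basic (~` A) u by rewrite sc_basicC.
have [||w []] := uv (sc_basic (~` A)) (sc_basic A).
- by apply/sc_nbhsP; exists (~` A).
- by apply/sc_nbhsP; exists A.
- by rewrite sc_basicC.
Qed.

Lemma sc_embed_dense : dense (range sc_embed).
Proof.
move=> W [u uW] oW.
have /sc_nbhsP[A uA AW] : nbhs u W by exact: open_nbhs_nbhs.
have [x Ax] := filter_ex (uA : sc_filter u A).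
exists (sc_embed x); split; last by exists x.
by apply: AW; exact/principal_filterP.
Qed.

Lemma sc_embed_isolated x : open [set sc_embed x].
Proof.
suff -> : [set sc_embed x] = sc_basic [set x] by exact: sc_basic_open.
rewrite predeqE => u; split=> [->|ux]; first exact/principal_filterP.
apply: stone_cech_inj.
apply: (@max_filter _ _ (principal_filter_ultra x) u) => A /principal_filterP Ax.
by apply: (@filterS _ u _ [set x] A) => // _ ->.
Qed.

Lemma stone_cech_boundary_closed : closed stone_cech_boundary.
Proof.
apply: open_closedC.
suff -> : range sc_embed = \bigcup_x [set sc_embed x].
  by apply: bigcup_open => x _; exact: sc_embed_isolated.
by rewrite predeqE => u; split=> [[x _ <-]|[x _ ->]]; exists x.
Qed.

End StoneCech.
Arguments stone_cech_boundary : clear implicits.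
Arguments sc_embed {T} x.

Section StoneCechMap.

Lemma fmap_ultra {T U : Type} (f : T -> U) (F : set_system T) :
  UltraFilter F -> UltraFilter (f @ F).
Proof.
move=> FU; split; first exact: fmap_proper_filter.
move=> H HP FH; rewrite eqEsubset; split=> // A HA.
have [//|FAC] := in_ultra_setVsetC (f @^-1` A) FU.
by have [x []] := filter_ex (filterI HA (FH (~` A) FAC)).
Qed.

(* The continuous extension of [f], i.e. the push-forward of ultrafilters. *)
Definition sc_map {T U : Type} (f : T -> U) (u : stone_cech T) : stone_cech U :=
  StoneCech (fmap_ultra f (sc_ultra u)).

Lemma sc_embed_cvg {T : Type} (u : stone_cech T) : sc_embed @ sc_filter u --> u.
Proof.
move=> W /sc_nbhsP[A uA AW].
apply: (@filterS _ u _ A) => // x Ax; apply: AW.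
exact/principal_filterP.
Qed.

Lemma stone_cech_universal (T : Type) (K : topologicalType) (f : T -> K) :
  compact [set: K] -> hausdorff_space K ->
  exists! F : stone_cech T -> K, continuous F /\ F \o sc_embed = f.
Proof.
move=> cK hK.
have lim_ex (u : stone_cech T) : exists p : K, f @ sc_filter u --> p.
  move: (cK); rewrite compact_ultra => /(_ (f @ sc_filter u) (fmap_ultra f (sc_ultra u))).
  by move=> /(_ (@filterT _ (f @ sc_filter u) _))[p [_ up]]; exists p.
have {lim_ex}[F FE] := choice lim_ex.
have Funiq u p : f @ sc_filter u --> p -> F u = p.
  by move=> up; apply: (cvg_unique hK (F := f @ sc_filter u)) => //; exact: FE.
exists F; split; [split|move=> F' [F'c F'f]].
- move=> u W FuW.
  have [V FuV VW] : filter_from (nbhs (F u)) closure W.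
    by apply: (compact_regular hK cK) => //; exact: filterT.
  apply/sc_nbhsP; exists (f @^-1` V); first exact: FE.
  move=> v vV; apply: VW => B /(FE v) vB.
  by have [x [? ?]] := filter_ex (filterI (vV : sc_filter v _) vB); exists (f x).
- apply/funext => x /=; apply: Funiq => W /nbhs_singleton.
  by move=> fxW; exact/principal_filterP.
- apply/funext => u; apply: Funiq.
  rewrite -F'f fmap_comp; apply: cvg_trans (F'c u).
  by apply: cvg_app; exact: sc_embed_cvg.
Qed.

Lemma sc_map_continuous {T U : Type} (f : T -> U) : continuous (sc_map f).
Proof.
move=> u W /sc_nbhsP[A uA AW]; apply/sc_nbhsP.
by exists (f @^-1` A) => // v vA; exact: AW.
Qed.

Lemma sc_map_embed {T U : Type} (f : T -> U) x :
  sc_map f (sc_embed x) = sc_embed (f x).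
Proof.
apply: stone_cech_inj.
apply: (@max_filter _ _ (principal_filter_ultra (f x)) _) => A /principal_filterP fxA.
exact/principal_filterP.
Qed.

Lemma sc_map_id {T : Type} (u : stone_cech T) : sc_map id u = u.
Proof. exact: stone_cech_inj. Qed.

Lemma sc_map_comp {T U V : Type} (f : T -> U) (g : U -> V) u :
  sc_map (g \o f) u = sc_map g (sc_map f u).
Proof. exact: stone_cech_inj. Qed.

Lemma sc_map_boundary {T U : Type} (f : T -> U) (g : U -> T) :
  cancel f g -> forall u,
  stone_cech_boundary T u -> stone_cech_boundary U (sc_map f u).
Proof.
move=> fK u bu [y _ yu]; apply: bu; exists (g y) => //.
rewrite -sc_map_embed yu -sc_map_comp -[RHS]sc_map_id.
by congr sc_map; apply/funext => x /=; exact: fK.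
Qed.

End StoneCechMap.

Section SetType.
Variables (X : topologicalType) (A : set X).

Lemma set_type_nbhsP (x : A) (W : set A) :
  nbhs x W <-> exists2 V, nbhs (\val x) V & \val @^-1` V `<=` W.
Proof.
split=> [[_ [[V oV <-] Vx VW]]|[V + VW]].
  by exists V => //; exact: open_nbhs_nbhs.
rewrite nbhsE => -[V' [oV' V'x] V'V].
exists (\val @^-1` V'); split=> //; first by exists V'.
by move=> y /V'V; exact: VW.
Qed.

Lemma set_type_compact : compact A -> compact [set: A].
Proof.
rewrite !compact_ultra => cA F FU _.
have [|x [Ax Fx]] := cA (\val @ F) (fmap_ultra (\val : A -> X) FU).
  by apply: (@filterS _ F _ setT) filterT => y _; exact: (set_valP y).
exists (SigSub (mem_set Ax)); split=> // W /set_type_nbhsP[V /Fx FV VW].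
exact: filterS VW FV.
Qed.

Lemma set_type_hausdorff : hausdorff_space X -> hausdorff_space A.
Proof.
move=> hX x y xy; apply/val_inj/hX => V W xV yW.
have [||z [? ?]] := xy (\val @^-1` V) (\val @^-1` W).
- by apply/set_type_nbhsP; exists V.
- by apply/set_type_nbhsP; exists W.
- by exists (\val z).
Qed.

End SetType.

Definition is_topological_action (G : groupType) (X : topologicalType)
    (act : G -> X -> X) : Prop :=
  [/\ forall x, act 1%g x = x,
      forall g h x, act (g * h)%g x = act g (act h x)
    & forall g, continuous (act g)].

Section BoundaryAction.
Context {G : groupType} (L : groupClosed G).

Lemma lcoset_actK (g : G) : cancel (lcoset_act (L:=L) g) (lcoset_act g^-1%g).
Proof. by move=> u; rewrite -lcoset_actM mulVg lcoset_act1. Qed.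

Definition lcosets_boundary : Type := stone_cech_boundary (lcosets_of L).
HB.instance Definition _ := Topological.on lcosets_boundary.

Definition boundary_act (g : G) (u : lcosets_boundary) : lcosets_boundary :=
  SigSub (mem_set (sc_map_boundary (lcoset_actK g) (set_mem (valP u)))).

Lemma boundary_act_topological : is_topological_action boundary_act.
Proof.
split=> [u|g h u|g u W /set_type_nbhsP[V uV VW]].
- apply: val_inj => /=; rewrite -[RHS]sc_map_id.
  by congr sc_map; apply/funext => x; rewrite lcoset_act1.
- apply: val_inj => /=; rewrite -sc_map_comp.
  by congr sc_map; apply/funext => x; rewrite lcoset_actM.
- apply/set_type_nbhsP; exists (sc_map (lcoset_act g) @^-1` V).
    exact: sc_map_continuous.
  by move=> v /= vV; exact: VW.
Qed.

Lemma lcosets_boundary_compact : compact [set: lcosets_boundary].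
Proof.
apply: set_type_compact; apply: subclosed_compact (@stone_cech_compact _) _ => //.
exact: stone_cech_boundary_closed.
Qed.

Lemma lcosets_boundary_hausdorff : hausdorff_space lcosets_boundary.
Proof. exact/set_type_hausdorff/stone_cech_hausdorff. Qed.

End BoundaryAction.
Arguments boundary_act {G} L g u.

Section Amenability.
Context {R : realType} {G : groupType}.

(* A probability measure on the discrete group [G] is given by its mass
   function; [{ptws G -> R}] carries the topology of pointwise convergence. *)
Definition prob_measures : set {ptws G -> R} :=
  [set p | (forall g, 0 <= p g) /\ (\esum_(g in [set: G]) (p g)%:E = 1)%E].

Definition left_translate (g : G) (p : G -> R) : G -> R :=
  fun h => p (g^-1 * h)%g.

Definition l1_dist (p q : G -> R) : \bar R :=
  (\esum_(g in [set: G]) `|p g - q g|%:E)%E.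

Lemma left_translate_prob g p :
  prob_measures p -> prob_measures (left_translate g p).
Proof.
move=> [p0 p1]; split=> [h|]; first exact: p0.
rewrite -p1 [RHS](reindex_esum setT setT (fun h => g^-1 * h)%g)//.
split=> [h//|h h' _ _ /mulgI//|h _].
by exists (g * h)%g => //; rewrite mulKg.
Qed.

End Amenability.
Arguments prob_measures : clear implicits.

Definition directed (I : Type) (le : I -> I -> Prop) : Prop :=
  [/\ inhabited I, forall i, le i i,
      forall i j k, le i j -> le j k -> le i k
    & forall i j, exists2 k, le i k & le j k].

Definition net_filter (I : Type) (le : I -> I -> Prop) : set_system I :=
  filter_from [set: I] (fun i => [set j | le i j]).

Definition topologically_amenable (R : realType) (G : groupType)
    (X : topologicalType) (act : G -> X -> X) : Prop :=
  exists (I : Type) (le : I -> I -> Prop) (mu : I -> X -> prob_measures R G),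
  [/\ directed le,
      forall i, continuous (mu i)
    & forall g : G,
      ereal_sup [set l1_dist (\val (mu i (act g x)))
                             (left_translate g (\val (mu i x))) | x in [set: X]]
        @[i --> net_filter le] --> 0%E].

Section FreeGroup.
Variable A : choiceType.
Implicit Types (a b : A * bool) (u v w : seq (A * bool)).

(* [(x, true)] stands for the generator [x], [(x, false)] for its inverse. *)
Definition inv_letter a : A * bool := (a.1, ~~ a.2).

Definition reduced w : bool := sorted (fun a b => b != inv_letter a) w.

Definition free_group : Type := {w : seq (A * bool) | reduced w}.
HB.instance Definition _ := Choice.on free_group.

Lemma inv_letterK : involutive inv_letter.
Proof. by case=> x e; rewrite /inv_letter negbK. Qed.

Definition reduce_cons a w : seq (A * bool) :=
  if w is b :: w' then if b == inv_letter a then w' else a :: w else [:: a].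

Lemma reduced_cons a w : reduced w -> reduced (reduce_cons a w).
Proof.
by case: w => [|b w]//= pw; case: ifPn => [_|ba]; [exact: path_sorted pw|rewrite /= ba].
Qed.

Lemma reduce_consK a w :
  reduced w -> reduce_cons (inv_letter a) (reduce_cons a w) = w.
Proof.
case: w => [|b w] /=; first by rewrite inv_letterK eqxx.
case: ifPn => [/eqP ->|ba]; last by rewrite /= inv_letterK eqxx.
by case: w => [|c w]//= /andP[/negPf ->].
Qed.

Lemma reduced_foldr u w : reduced w -> reduced (foldr reduce_cons w u).
Proof. by move=> rw; elim: u => //= a u; exact: reduced_cons. Qed.

Lemma foldr_reduce_cons a v w : reduced v -> reduced w ->
  foldr reduce_cons w (reduce_cons a v) = reduce_cons a (foldr reduce_cons w v).
Proof.
case: v => [|b v]//= rv rw; case: ifPn => //= /eqP ->.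
rewrite -{1}[a]inv_letterK reduce_consK//; exact: reduced_foldr.
Qed.

Lemma foldr_reduced w : reduced w -> foldr reduce_cons [::] w = w.
Proof.
elim: w => //= a w IHw rw; rewrite IHw; last exact: path_sorted rw.
by case: w rw {IHw} => //= b w /andP[/negPf ->].
Qed.

Definition inv_word w := rev (map inv_letter w).

Lemma reduced_inv w : reduced w -> reduced (inv_word w).
Proof.
rewrite /reduced /inv_word rev_sorted sorted_map.
apply: sub_sorted => a b /=; apply: contra => /eqP ab.
by rewrite ab inv_letterK.
Qed.

Definition FreeWord w (rw : reduced w) : free_group := exist _ w rw.

Definition free_one : free_group := @FreeWord [::] isT.
Definition free_mul (u v : free_group) : free_group :=
  FreeWord (reduced_foldr (val u) (valP v)).
Definition free_inv (u : free_group) : free_group :=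
  FreeWord (reduced_inv (valP u)).

Lemma free_mul1w : left_id free_one free_mul.
Proof. by move=> u; exact: val_inj. Qed.

Lemma free_mulw1 : right_id free_one free_mul.
Proof. by move=> u; apply: val_inj; exact/foldr_reduced/valP. Qed.

Lemma free_mulA : associative free_mul.
Proof.
move=> [u ru] [v rv] [w rw]; apply: val_inj => /= {ru}.
elim: u => //= a u ->; rewrite foldr_reduce_cons//; exact: reduced_foldr.
Qed.

Lemma free_mulVw : left_inverse free_one free_inv free_mul.
Proof.
move=> [w rw]; apply: val_inj => /=; elim: w rw => //= a w IHw rw.
rewrite /inv_word /= rev_cons foldr_rcons.
have -> : reduce_cons (inv_letter a) (a :: w) = w by rewrite /= inv_letterK eqxx.
exact/IHw/(path_sorted rw).
Qed.

Lemma inv_wordK : involutive inv_word.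
Proof.
move=> w; rewrite /inv_word map_rev revK -map_comp -[RHS]map_id.
by apply: eq_map; exact: inv_letterK.
Qed.

Lemma free_mulwV : right_inverse free_one free_inv free_mul.
Proof.
move=> w; rewrite -[X in free_mul X](_ : free_inv (free_inv w) = w).
  exact: free_mulVw.
by apply: val_inj; exact: inv_wordK.
Qed.

HB.instance Definition _ := isGroup.Build free_group
  free_mulA free_mul1w free_mulw1 free_mulVw free_mulwV.

Definition free_gen (x : A) : free_group := @FreeWord [:: (x, true)] isT.

Lemma free_group_universal (H : groupType) (f : A -> H) :
  exists! F : free_group -> H,
    (forall u v : free_group, F (u * v)%g = (F u * F v)%g) /\ (forall x, F (free_gen x) = f x).
Proof.
pose ev a : H := if a.2 then f a.1 else (f a.1)^-1%g.
have evV a : ev (inv_letter a) = (ev a)^-1%g.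
  by case: a => x [] /=; rewrite /ev/= ?invgK.
pose evw w : H := foldr (fun a h => ev a * h)%g 1%g w.
have evc a w : evw (reduce_cons a w) = (ev a * evw w)%g.
  by case: w => [|b w]//=; case: ifPn => // /eqP ->; rewrite /= evV mulVKg.
have evM u w : evw (foldr reduce_cons w u) = (evw u * evw w)%g.
  by elim: u => [|a u IHu] /=; rewrite ?mul1g// evc IHu mulgA.
exists (fun u : free_group => evw (val u)); split.
  by split=> [u v|x] /=; [exact: evM|rewrite /ev mulg1].
move=> F [FM Fg]; apply/funext => -[w rw] /=.
have F1 : F 1%g = 1%g by apply: (@mulgI _ (F 1%g)); rewrite -FM !mulg1.
have FV (u : free_group) : F u^-1%g = (F u)^-1%g.
  by apply: (@mulgI _ (F u)); rewrite -FM !mulgV.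
elim: w rw => [|a w IHw] rw /=; first by rewrite -F1; congr F; exact: val_inj.
have rw' := path_sorted rw; rewrite (IHw rw').
have Fa : F (@FreeWord [:: a] isT) = ev a.
  case: a {rw} => x [] /=; rewrite /ev /= -Fg//.
  by rewrite -FV; congr F; exact: val_inj.
rewrite -Fa -FM; congr F; apply: val_inj => /=.
by case: w rw {rw' IHw} => //= b w /andP[/negPf ->].
Qed.

End FreeGroup.

(* Main.v *)
(* Quasiconvexity of [L] makes the nearest-point projection onto a coset coarsely
   well defined, so a shortest representative [s u] of each coset [u] satisfies
   [d (g * s u) (s (g u)) <= c g] for all [u], and [s u] goes to infinity with [u].
   For [x, z] in the group let the shadow [S_k (x, z)] be the set of points at a
   fixed distance from [x'] on geodesics from [x'] to [z'], where [x'] and [z']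
   range over the balls of radius [k] around [x] and [z].  By hyperbolicity all
   these points are close to one geodesic, so [S_k] has linearly many points once
   [z] is far away, and moving [x] and [z] by at most [c] replaces [S_k] by a set
   between [S_(k-c)] and [S_(k+c)].  Hence the averages over [n <= k < 2 n] of the
   uniform measures on [S_k (1, s u)] are almost equivariant, with an error
   [O (log n / n)], for all but finitely many [u].  For fixed [n] they take
   finitely many values, so they extend to locally constant maps on the boundary.
   Undistorted subgroups are quasiconvex by the Morse lemma; finitely generated
   subgroups of free groups are so because prefixes of a reduced product stay
   near the partial products. *)

Require Import Defs.
From HB Require Import structures.
From mathcomp Require Import all_boot all_order all_algebra finmap zify lra ring.
From mathcomp Require Import all_classical all_reals all_analysis.
Import numFieldNormedType.Exports.
Set Implicit Arguments.
Unset Strict Implicit.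
Unset Printing Implicit Defensive.
Import Order.TTheory GRing.Theory Num.Theory.
Local Open Scope classical_set_scope.
Local Open Scope ring_scope.

(** * Averages of uniform measures *)

Section UniformMeasures.
Context {R : realType} {T : choiceType}.
Implicit Types (A B C D F : {fset T}).
Local Open Scope fset_scope.
Local Open Scope ring_scope.

Definition unif A (g : T) : R := (g \in A)%:R / #|` A|%:R.

Lemma unif_ge0 A g : 0 <= unif A g.
Proof. by rewrite /unif divr_ge0// ler0n. Qed.

Lemma unif_out A F g : A `<=` F -> g \notin F -> unif A g = 0.
Proof.
move=> /fsubsetP AF gF; rewrite /unif; case: (boolP (g \in A)) => [/AF|_].
  by rewrite (negPf gF).
by rewrite mul0r.
Qed.

Lemma sum_mem_fset A F : A `<=` F ->
  \sum_(g <- F) (g \in A)%:R = #|` A|%:R :> R.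
Proof.
move=> /fsubsetP AF; rewrite (eq_bigr (fun g => if g \in A then 1 else 0)).
  rewrite -big_mkcond big_fset_condE /= (_ : [fset _ in F | _] = A).
    by rewrite big_const_seq count_predT iter_addr_0.
  by apply/fsetP => g; rewrite !inE /= andb_idl// => /AF.
by move=> g _; case: (g \in A).
Qed.

Lemma sum_unif A F : A `<=` F -> A != fset0 -> \sum_(g <- F) unif A g = 1.
Proof.
move=> AF A0; rewrite -mulr_suml sum_mem_fset// divff//.
by rewrite pnatr_eq0 cardfs_eq0.
Qed.

(** On [C] both densities are at least [1 / |D|], which saves [2 / |D|] in [|a - b| <= a + b]. *)
Lemma dist_unif A B C D : C `<=` A -> C `<=` B -> A `<=` D -> B `<=` D ->
  C != fset0 ->
  \sum_(g <- D) `|unif A g - unif B g| <= 2 * (1 - #|` C|%:R / #|` D|%:R).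
Proof.
move=> CA CB AD BD C0.
have A0 : A != fset0 by apply: contraNneq C0 => A0; rewrite -fsubset0 -A0.
have B0 : B != fset0 by apply: contraNneq C0 => B0; rewrite -fsubset0 -B0.
have -> : 2 * (1 - #|` C|%:R / #|` D|%:R) =
    \sum_(g <- D) (unif A g + unif B g - 2 * ((g \in C)%:R / #|` D|%:R)).
  rewrite sumrB big_split /= !sum_unif// -mulr_sumr -mulr_suml sum_mem_fset//.
    ring.
  exact: fsubset_trans AD.
apply: ler_sum => g _; case: (boolP (g \in C)) => gC; last first.
  rewrite mul0r mulr0 subr0; apply: le_trans (ler_normB _ _) _.
  by rewrite !ger0_norm// unif_ge0.
have le_inv X : g \in X -> X `<=` D -> (#|` D|%:R)^-1 <= (#|` X|%:R)^-1 :> R.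
  move=> gX XD; rewrite lef_pV2 ?ler_nat ?fsubset_leq_card// posrE ltr0n.
    by rewrite cardfs_gt0; apply/fset0Pn; exists g; apply: (fsubsetP XD).
  by rewrite cardfs_gt0; apply/fset0Pn; exists g.
have gA := fsubsetP CA _ gC; have gB := fsubsetP CB _ gC.
have := le_inv A gA AD; have := le_inv B gB BD.
rewrite /unif gA gB !mul1r => hB hA; rewrite ler_norml; lra.
Qed.

(** [ln (1 + x) <= x] at [x = c / d - 1]: ratios of cardinalities become differences that
    telescope. *)
Lemma one_sub_ratio_le_ln (c d : nat) : (0 < c)%N -> (0 < d)%N ->
  1 - c%:R / d%:R <= ln d%:R - ln c%:R :> R.
Proof.
move=> c0 d0; have c0' : 0 < c%:R :> R by rewrite ltr0n.
have d0' : 0 < d%:R :> R by rewrite ltr0n.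
rewrite -lerN2 !opprB -ln_div ?posrE//.
have -> : c%:R / d%:R = 1 + (c%:R / d%:R - 1) :> R by ring.
apply: le_trans (le_ln1Dx _) _; last lra.
by rewrite ltrBrDl subrr divr_gt0.
Qed.

(** A shift by [c] is [c] unit shifts; that from [j] to [j + 1] telescopes to [f (n + j) - f j], at
    most [f (n + c)]. *)
Lemma telescoping_shift (f : nat -> R) (n c : nat) :
  {homo f : i j / (i <= j)%N >-> i <= j} -> 0 <= f 0 ->
  \sum_(k < n) (f (k + c)%N - f k) <= c%:R * f (n + c)%N.
Proof.
move=> fmono f0; elim: c => [|c IH].
  by rewrite mul0r big1// => k _; rewrite addn0 subrr.
have -> : \sum_(k < n) (f (k + c.+1)%N - f k) =
    \sum_(k < n) (f (k + c)%N - f k) + \sum_(k < n) (f (k + c).+1 - f (k + c)%N).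
  by rewrite -big_split; apply: eq_bigr => k _ /=; rewrite addnS; ring.
have -> : \sum_(k < n) (f (k + c).+1 - f (k + c)%N) = f (n + c)%N - f c.
  elim: n {IH} => [|m IH]; first by rewrite big_ord0 subrr.
  by rewrite big_ord_recr IH /= addSn; ring.
have h1 : f (n + c)%N <= f (n + c.+1)%N by apply: fmono; lia.
have h2 : f 0 <= f c by apply: fmono.
have h3 := ler_wpM2l (ler0n R c) h1.
by rewrite -natr1 mulrDl mul1r; lra.
Qed.

Lemma esum_finite_support F (p : T -> R) :
  (forall g, 0 <= p g) -> (forall g, g \notin F -> p g = 0) ->
  (\esum_(g in [set: T]) (p g)%:E = (\sum_(g <- F) p g)%:E)%E.
Proof.
move=> p0 pF.
have -> : (\esum_(g in [set: T]) (p g)%:E = \esum_(g in [set` F]) (p g)%:E)%E.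
  rewrite [RHS]esum_mkcond; apply: eq_esum => g _.
  by rewrite mem_setE; case: ifPn => // /pF ->.
rewrite esum_fset//=; last by move=> g _; rewrite lee_fin.
by rewrite fsbig_finite//= set_fsetK sumEFin.
Qed.

(** The window starts at [n] so that its indices can be lowered by any [c <= n]. *)
Definition average (n : nat) (A : nat -> {fset T}) (g : T) : R :=
  n%:R^-1 * \sum_(k < n) unif (A (n + k)%N) g.

Lemma average_ge0 n (A : nat -> {fset T}) g : 0 <= average n A g.
Proof. by rewrite mulr_ge0 ?invr_ge0 ?ler0n// sumr_ge0// => k _; exact: unif_ge0. Qed.

Lemma average_out n (A : nat -> {fset T}) F g :
  (forall k, (k < 2 * n)%N -> A k `<=` F) -> g \notin F -> average n A g = 0.
Proof.
move=> AF gF; rewrite /average big1 ?mulr0// => k _.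
by apply: unif_out gF; apply: AF; have := ltn_ord k; lia.
Qed.

Lemma sum_average n (A : nat -> {fset T}) F : (0 < n)%N ->
  (forall k, (k < 2 * n)%N -> A k `<=` F) -> (forall k, A k != fset0) ->
  \sum_(g <- F) average n A g = 1.
Proof.
move=> n0 AF A0; rewrite -mulr_sumr exchange_big /=.
rewrite (eq_bigr (fun=> 1)); last first.
  by move=> k _; apply: sum_unif => //; apply: AF; have := ltn_ord k; lia.
by rewrite sumr_const card_ord mulVf// pnatr_eq0; lia.
Qed.

End UniformMeasures.

(** * Averages on groups and their [l1] distance *)

Section AveragesOnGroups.
Context {R : realType} {G : groupType}.
Local Open Scope fset_scope.
Local Open Scope ring_scope.

Lemma average_prob n (A : nat -> {fset G}) : (0 < n)%N ->
  {homo A : i j / (i <= j)%N >-> i `<=` j} -> A 0 != fset0 ->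
  prob_measures R G (average n A).
Proof.
move=> n0 Amono A0; split=> [g|]; first exact: average_ge0.
have AF k : (k < 2 * n)%N -> A k `<=` A (2 * n)%N by move=> kn; apply: Amono; lia.
rewrite (@esum_finite_support _ _ (A (2 * n)%N)).
- rewrite sum_average// => k; apply: contraNneq A0 => Ak.
  by rewrite -fsubset0 -Ak; exact: Amono.
- by move=> g; exact: average_ge0.
- by move=> g; exact: average_out.
Qed.

(* Each term of the average costs at most [2 (1 - |A (k - c)| / |A (k + c)|)],
   which is bounded by a logarithmic increment of [k |-> |A k|]; these telescope. *)
Lemma l1_dist_average n c (A B : nat -> {fset G}) : (0 < n)%N -> (c <= n)%N ->
  {homo A : i j / (i <= j)%N >-> i `<=` j} -> A 0 != fset0 ->
  (forall k, A k `<=` B (k + c)%N) -> (forall k, B k `<=` A (k + c)%N) ->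
  (l1_dist (average n A : G -> R) (average n B) <=
    (4 * c%:R / n%:R * ln #|` A (3 * n)%N|%:R)%:E)%E.
Proof.
move=> n0 cn Amono A0 AB BA; set F := A (3 * n)%N.
have Apos k : (0 < #|` A k|)%N.
  rewrite cardfs_gt0; apply: contraNneq A0 => Ak.
  by rewrite -fsubset0 -Ak; exact: Amono.
have AF k : (k <= 3 * n)%N -> A k `<=` F by move=> ?; exact: Amono.
have BF k : (k < 2 * n)%N -> B k `<=` F.
  by move=> ?; apply: fsubset_trans (BA k) _; apply: AF; lia.
rewrite /l1_dist (@esum_finite_support _ _ F); last 2 first.
- by [].
- move=> g gF; rewrite (@average_out _ _ _ _ F)// => [|k kn]; last by apply: AF; lia.
  by rewrite (@average_out _ _ _ _ F)// subrr normr0.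
rewrite lee_fin; have nR : 0 < n%:R :> R by rewrite ltr0n.
(* With this offset [A (n + k - c)] and [A (n + k + c)] correspond to [f k] and [f (k + 2 * c)]. *)
pose f k : R := ln #|` A (n - c + k)%N|%:R.
have term (k : 'I_n) : \sum_(g <- F) `|unif (A (n + k)%N) g - unif (B (n + k)%N) g|
    <= 2 * (f (k + 2 * c)%N - f k).
  have kn := ltn_ord k; pose D := A (n + k + c)%N; pose C := A (n + k - c)%N.
  have DF : D `<=` F by apply: AF; lia.
  have AD : A (n + k)%N `<=` D by apply: Amono; lia.
  have BD : B (n + k)%N `<=` D by exact: BA.
  have CB : C `<=` B (n + k)%N by have := AB (n + k - c)%N; rewrite subnK//; lia.
  have -> : \sum_(g <- F) `|unif (A (n + k)%N) g - unif (B (n + k)%N) g| =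
      \sum_(g <- D) `|unif (A (n + k)%N) g - unif (B (n + k)%N) g| :> R.
    apply/esym/big_fset_incl => // g _ gD.
    by rewrite !(@unif_out _ _ _ D)// subrr normr0.
  apply: le_trans (dist_unif (C := C) _ CB AD BD _) _.
  - by apply: Amono; lia.
  - by rewrite -cardfs_gt0 Apos.
  rewrite ler_pM2l//; apply: le_trans (one_sub_ratio_le_ln (Apos _) (Apos _)) _.
  have e1 : (n + k + c = n - c + (k + 2 * c))%N by lia.
  have e2 : (n + k - c = n - c + k)%N by lia.
  by rewrite e1 e2.
have fmono : {homo f : i j / (i <= j)%N >-> i <= j}.
  move=> i j ij; rewrite ler_ln ?posrE ?ltr0n// ler_nat.
  by apply: fsubset_leq_card; apply: Amono; lia.
have f0 : 0 <= f 0 by rewrite ln_ge0// ler1n.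
have := telescoping_shift n (2 * c) fmono f0.
have -> : f (n + 2 * c)%N = ln #|` A (2 * n + c)%N|%:R.
  by rewrite /f; have -> : (n - c + (n + 2 * c) = 2 * n + c)%N by lia.
have lnle : ln #|` A (2 * n + c)%N|%:R <= ln #|` F|%:R :> R.
  have F0 : (0 < #|` F|)%N := Apos _.
  by rewrite ler_ln ?posrE ?ltr0n// ler_nat fsubset_leq_card// AF//; lia.
move=> tele.
have step : \sum_(g <- F) `|average n A g - average n B g| <=
    n%:R^-1 * \sum_(k < n) \sum_(g <- F) `|unif (A (n + k)%N) g - unif (B (n + k)%N) g| :> R.
  rewrite exchange_big /= mulr_sumr; apply: ler_sum => g _.
  rewrite /average -mulrBr normrM ger0_norm ?invr_ge0 ?ler0n//.
  by rewrite ler_pM2l ?invr_gt0// -sumrB ler_norm_sum.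
apply: le_trans step _; rewrite [leRHS](_ : _ = n%:R^-1 * (4 * c%:R * ln #|` F|%:R)); last first.
  by ring.
rewrite ler_pM2l ?invr_gt0//; apply: le_trans (ler_sum _ (fun k _ => term k)) _.
rewrite -mulr_sumr.
have := ler_wpM2l (ler0n R (2 * c)) lnle.
rewrite natrM => h; move: tele; rewrite natrM; lra.
Qed.

End AveragesOnGroups.

(** * Maps on the Stone-Cech boundary *)

Lemma ultrafilter_finite_value (T : Type) (U : eqType) (F : set_system T) (f : T -> U) :
  UltraFilter F -> finite_set (range f) -> exists v, F [set x | f x = v].
Proof.
move=> FU /finite_seqP[s fs].
have : F [set x | f x \in s].
  apply: filterS (@filterT _ F _) => x _ /=.
  by have : range f (f x) by []; rewrite fs.
elim: s {fs} => [|v s IH] Fs.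
  by have [x] := filter_ex Fs.
have [Fv|Fv] := in_ultra_setVsetC [set x | f x = v] FU; first by exists v.
apply: IH; apply: filterS (filterI Fs Fv) => x [/=].
by rewrite inE => /orP[/eqP|].
Qed.

(** An ultrafilter with a finite member contains a singleton, hence is principal. *)
Lemma boundary_finite_compl (T : choiceType) (u : stone_cech T) (A : set T) :
  stone_cech_boundary T u -> cofinite_set A -> sc_filter u A.
Proof.
move=> bu Afin; have [//|uA] := in_ultra_setVsetC A (sc_ultra u).
have /finite_seqP[s sE] := Afin.
have {}uA : sc_filter u [set x | x \in s] by rewrite sE in uA.
exfalso; elim: s {sE} uA => [|y s IH] us.
  by have [x] := filter_ex us.
have [uy|uy] := in_ultra_setVsetC [set y] (sc_ultra u).
  apply: bu; exists y => //; apply: stone_cech_inj; apply/esym.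
  apply: (@max_filter _ _ (principal_filter_ultra y) u) => B /principal_filterP By.
  by apply: (@filterS _ u _ [set y] B) => // _ ->.
apply: IH; apply: filterS (filterI us uy) => x [/=].
by rewrite inE => /orP[/eqP|].
Qed.

(** Ultrafilters refining the cofinite filter are boundary points. Nonemptiness keeps suprema over
    the boundary above minus infinity. *)
Lemma stone_cech_boundary_nonempty (T : choiceType) :
  infinite_set [set: T] -> stone_cech_boundary T !=set0.
Proof.
move=> Tinf; pose F : set_system T := [set A | cofinite_set A].
have FF : ProperFilter F.
  split; first by rewrite /F/= setC0.
  split; first by rewrite /F/= setCT.
    by move=> A B FA FB; rewrite /F/= setCI finite_setU.
  by move=> A B /subsetC BA; exact: sub_finite_set.
have [U [UU FU]] := @ultraFilterLemma _ F FF.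
exists (StoneCech UU) => -[x _ xU].
have Ux : U [set x].
  have : sc_filter (sc_embed x) [set x] by exact/principal_filterP.
  by rewrite xU.
have Uc : U (~` [set x]).
  by apply: FU; rewrite /F/= setCK.
by have [y []] := filter_ex (filterI Ux Uc).
Qed.

Lemma cvg_net_nat_ereal0 (R : realType) (e : nat -> \bar R) :
  (forall i, 0 <= e i)%E ->
  (forall eps : R, 0 < eps -> exists N, forall i, (N <= i)%N -> (e i <= eps%:E)%E) ->
  e i @[i --> net_filter (fun i j => (i <= j)%N)] --> 0%E.
Proof.
move=> e0 he W W0.
have [eps /= eps0 epsW] : \forall r \near (0 : R), W r%:E by exact: W0.
have [N hN] := he (eps / 2) (divr_gt0 eps0 (ltr0Sn _ 1)).
exists N => // i /= Ni; have := e0 i; have := hN i Ni; rewrite /mkset/=.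
case: (e i) => [r||]//; rewrite !lee_fin => h1 h2.
by apply: epsW; rewrite /ball_ /= sub0r normrN ger0_norm//; lra.
Qed.

(** * From asymptotic equivariance on cosets to the boundary *)

Section AmenableOfAsymptotic.
Context {R : realType} {G : groupType} (L : groupClosed G).

(* A finitely valued map on the cosets extends to a locally constant map on the
   boundary: an ultrafilter selects one of the finitely many values. *)
Lemma amenable_of_asymptotic (mu : nat -> lcosets_of L -> G -> R) :
  infinite_set [set: lcosets_of L] ->
  (forall n, finite_set (range (mu n))) ->
  (forall n u, prob_measures R G (mu n u)) ->
  (forall g (eps : R), 0 < eps -> exists N, forall n, (N <= n)%N ->
     cofinite_set [set u | (l1_dist (mu n (lcoset_act g u))
       (left_translate g (mu n u)) <= eps%:E)%E]) ->
  topologically_amenable R (boundary_act L).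
Proof.
move=> Linf mufin muprob muinv.
have val_ex (nu : nat * lcosets_boundary L) :
    exists p : prob_measures R G,
      sc_filter (\val nu.2) [set u | mu nu.1 u = \val p].
  case: nu => n u.
  have [p up] := ultrafilter_finite_value (sc_ultra (\val u)) (mufin n).
  have [x xp] := filter_ex up.
  have pp : prob_measures R G p by rewrite -xp.
  by exists (SigSub (mem_set pp)).
have [M MP] := choice val_ex.
have Mval n (u : lcosets_boundary L) p :
    sc_filter (\val u) [set x | mu n x = p] -> \val (M (n, u)) = p.
  by move=> up; have [x [/= <- <-]] := filter_ex (filterI (MP (n, u)) up).
exists nat, (fun i j => (i <= j)%N), (fun n u => M (n, u)); split.
- split=> [|//|i j k ij jk|i j]; first exact: (inhabits 0%N).
    exact: leq_trans jk.
  by exists (maxn i j); rewrite ?leq_maxl ?leq_maxr.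
- move=> n u W MW; apply/set_type_nbhsP.
  exists (sc_basic [set x | mu n x = \val (M (n, u))]).
    by apply/sc_nbhsP; exists [set x | mu n x = \val (M (n, u))] => //; exact: (MP (n, u)).
  move=> v /= vM; have -> : M (n, v) = M (n, u) by apply/val_inj/Mval.
  exact: nbhs_singleton MW.
- move=> g; apply: cvg_net_nat_ereal0 => [n|eps eps0].
    have [u bu] := stone_cech_boundary_nonempty Linf.
    apply: le_trans (ereal_sup_ubound _); last first.
      by exists (SigSub (mem_set bu)).
    by apply: esum_ge0 => h _; rewrite lee_fin.
  have [N hN] := muinv g eps eps0; exists N => n Nn.
  apply: ge_ereal_sup => _ [u _ <-].
  have bu : stone_cech_boundary (lcosets_of L) (\val u) by exact: set_valP.
  have u1 := boundary_finite_compl bu (hN n Nn).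
  (* The three sets belong to one ultrafilter, so a single coset [x] realizes both limit values and
     satisfies the bound. *)
  have [x /= [[/= x1 x2] x3]] :=
    filter_ex (filterI (filterI (MP (n, u)) u1) (MP (n, boundary_act L g u))).
  by rewrite -x1 -x3.
Qed.

End AmenableOfAsymptotic.

(** * Shadows *)

(* [hl_four] is the four-point condition for the left-invariant metric
   [d x y = len (x^-1 * y)], multiplied by two so that it lives in [nat]:
   [D] plays the role of twice the hyperbolicity constant. *)
Record hyperbolic_length (G : groupType) (len : G -> nat) (D : nat) : Prop :=
  HyperbolicLength {
  hl_one : len 1%g = 0 ;
  hl_inv : forall g, len g^-1%g = len g ;
  hl_mul : forall g h, (len (g * h)%g <= len g + len h)%N ;
  hl_geodesic : forall g i, (i <= len g)%N ->
    exists2 p, len p = i & len (p^-1 * g)%g = (len g - i)%N ;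
  hl_finite : forall n, finite_set [set g | (len g <= n)%N] ;
  hl_four : forall x y z o,
    (len (x^-1 * z)%g + len (y^-1 * o)%g <=
     maxn (len (x^-1 * y)%g + len (z^-1 * o)%g)
          (len (y^-1 * z)%g + len (x^-1 * o)%g) + D)%N }.

Section Shadows.
Context {G : groupType} {len : G -> nat} {D : nat}.
Hypothesis hL : hyperbolic_length len D.
Local Open Scope nat_scope.

Definition ldist (x y : G) : nat := len (x^-1 * y)%g.
Local Notation d := ldist.

Lemma ldistxx x : d x x = 0.
Proof. by rewrite /d mulVg (hl_one hL). Qed.

Lemma ldistC x y : d x y = d y x.
Proof. by rewrite /d -(hl_inv hL) invgM invgK. Qed.

Lemma ldist_triangle y x z : d x z <= d x y + d y z.
Proof.
rewrite /d; have -> : (x^-1 * z = x^-1 * y * (y^-1 * z))%g by rewrite mulgA mulgK.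
exact: hl_mul hL _ _.
Qed.

Lemma ldist_mull g x y : d (g * x)%g (g * y)%g = d x y.
Proof. by rewrite /d invgM -mulgA mulKg. Qed.

Lemma ldist1 x : d 1%g x = len x.
Proof. by rewrite /d invg1 mul1g. Qed.

Lemma ldist_geodesic x y i : i <= d x y ->
  exists2 m, d x m = i & d m y = d x y - i.
Proof.
move=> /(hl_geodesic hL)[p pi pg]; exists (x * p)%g; rewrite /d ?mulKg//.
by rewrite invgM -mulgA.
Qed.

Lemma ldist_four x y z o :
  d x z + d y o <= maxn (d x y + d z o) (d y z + d x o) + D.
Proof. exact: hl_four hL _ _ _ _. Qed.

Lemma finite_ldist x n : finite_set [set p | d x p <= n].
Proof.
apply: sub_finite_set (finite_image (fun g => x * g)%g (hl_finite hL n)) => p /= pn.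
by exists (x^-1 * p)%g => //; rewrite mulVKg.
Qed.

(** The equations place [p] on a geodesic from [x'] to [z'], at distance [l] from [x']. *)
Definition shadow (l k : nat) (x z : G) : set G :=
  [set p | exists x' z', [/\ d x x' <= k, d z z' <= k, d x' p = l &
    l + d p z' = d x' z']].

(** The same [x'] and [z'] serve; only the balls around the ends change. *)
Lemma shadow_move l k c x z y w : d x y <= c -> d z w <= c ->
  shadow l k x z `<=` shadow l (k + c) y w.
Proof.
move=> xy zw p [x' [z' [xx' zz' pl pz]]]; exists x', z'; split=> //.
  by have := ldist_triangle x y x'; rewrite (ldistC y x); lia.
by have := ldist_triangle z w z'; rewrite (ldistC w z); lia.
Qed.

Lemma shadow_mono l x z : {homo (fun k => shadow l k x z) : i j / i <= j >-> i `<=` j}.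
Proof.
move=> i j ij; rewrite -(subnKC ij).
by apply: shadow_move; rewrite ldistxx.
Qed.

Lemma shadow_mull l k g x z p :
  shadow l k (g * x)%g (g * z)%g p <-> shadow l k x z (g^-1 * p)%g.
Proof.
split=> -[x' [z' [h1 h2 h3 h4]]].
  exists (g^-1 * x')%g, (g^-1 * z')%g.
  by rewrite !ldist_mull -(ldist_mull g x) -(ldist_mull g z) !mulVKg.
exists (g * x')%g, (g * z')%g; rewrite !ldist_mull.
by rewrite -(ldist_mull g x' (g^-1 * p)%g) mulVKg in h3;
   rewrite -(ldist_mull g (g^-1 * p)%g) mulVKg in h4.
Qed.

Lemma shadow_near l k x z p : shadow l k x z p -> d x p <= l + k.
Proof.
by move=> [x' [z' [xx' _ pl _]]]; have := ldist_triangle x' x p; lia.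
Qed.

Lemma shadow_finite l k x z : finite_set (shadow l k x z).
Proof.
by apply: sub_finite_set (finite_ldist x (l + k)) => p; exact: shadow_near.
Qed.

Lemma shadow_nonempty l x z : l <= d x z -> shadow l 0 x z !=set0.
Proof.
move=> lxz; have [m xm mz] := ldist_geodesic lxz; exists m, x, z.
by rewrite !ldistxx xm mz; split=> //; lia.
Qed.

(** The four-point inequality bounds [d q p + d x z] by sums that are at most [d x z + 2 * D], plus
    [D]. *)
Lemma near_geodesic x z p q :
  d x p + d p z <= d x z + 2 * D -> d x q = d x p -> d q z = d x z - d x p ->
  d x p <= d x z -> d q p <= 3 * D.
Proof.
move=> h1 h2 h3 h4; have := ldist_four p z q x.
rewrite (ldistC z x) (ldistC z q) (ldistC q x) (ldistC p x) (ldistC p q); lia.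
Qed.

(** Passing from [x'] to [x] and from [z'] to [z] costs [D] each; the two size hypotheses exclude
    the other term of each maximum. *)
Lemma shadow_near_geodesic l k x z p : k + D < l -> 3 * k + l + D < d x z ->
  shadow l k x z p -> d x p + d p z <= d x z + 2 * D.
Proof.
move=> kl lz [x' [z' [xx' zz' pl pz]]].
have f1 := ldist_four x' x z' p; have f2 := ldist_four x z z' p.
have t1 := ldist_triangle x x' p; have t2 := ldist_triangle x' x z.
have t3 := ldist_triangle z' x' z; have t4 := ldist_triangle z z' p.
have t5 := ldist_triangle z' x z.
move: f1 f2 t1 t2 t3 t4 t5.
rewrite (ldistC x' x) (ldistC z' z) (ldistC z p) (ldistC z' p); lia.
Qed.

(** Each point is within [3 * D] of some [q j] with [j <= l + k], which makes the bound linear in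
    [l + k]. *)
Lemma shadow_card l k x z : k + D < l -> 3 * k + l + D < d x z ->
  (#|` fset_set (shadow l k x z)| <=
   (l + k).+1 * #|` fset_set [set g | (len g <= 3 * D)%N]|)%N.
Proof.
move=> kl lz.
have /choice[q qP] j : exists m, j <= d x z -> d x m = j /\ d m z = d x z - j.
  have [/ldist_geodesic[m xm mz]|zj] := leqP j (d x z); first by exists m.
  by exists x.
set B := fset_set [set g | (len g <= _)%N]; pose s := [seq (q j * b)%g | j <- iota 0 (l + k).+1, b <- B].
have -> : (l + k).+1 * #|` B| = size s by rewrite size_allpairs size_iota.
apply: uniq_leq_size => // p; rewrite in_fset_set; last exact: shadow_finite.
rewrite inE => ps; have pg := shadow_near_geodesic kl lz ps.
have plk := shadow_near ps.
have pz : d x p <= d x z by lia.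
have [xq qz] := qP _ pz.
apply/allpairsP; exists (d x p, ((q (d x p))^-1 * p)%g); split.
- by rewrite -[_.1]/(d x p) mem_iota; lia.
- rewrite in_fset_set; last exact: hl_finite hL _.
  by rewrite inE; exact: near_geodesic qz pz.
- by rewrite /= mulVKg.
Qed.

End Shadows.
Arguments ldist {G} len x y.
Arguments shadow {G} len l k x z.

(** [ln y = 2 * ln (sqrt y) <= 2 * sqrt y] bounds the left side by [8 * c * sqrt (K / n)], which is
    at most [eps] once [n >= C]. *)
Lemma log_average_small (R : realType) (c K : nat) (eps : R) : (0 < K)%N -> 0 < eps ->
  exists N, forall n, (N <= n)%N -> 4 * c%:R / n%:R * ln (n * K)%:R <= eps.
Proof.
move=> K0 eps0; pose C : R := 64 * c%:R ^+ 2 * K%:R / eps ^+ 2.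
have C0 : 0 <= C by rewrite divr_ge0 ?sqr_ge0// !mulr_ge0 ?sqr_ge0 ?ler0n.
exists (Num.trunc C).+1 => n Nn.
have nC : C <= n%:R.
  by apply: le_trans (ltW (truncnS_gt _)) _; rewrite ler_nat.
have n0 : 0 < n%:R :> R by rewrite ltr0n; lia.
have nK0 : 0 < (n * K)%:R :> R by rewrite ltr0n muln_gt0 K0 andbT; lia.
pose r : R := Num.sqrt (n * K)%:R.
have r0 : 0 < r by rewrite sqrtr_gt0.
have r2 : r ^+ 2 = n%:R * K%:R by rewrite sqr_sqrtr ?ltW// natrM.
have -> : ln (n * K)%:R = 2 * ln r :> R.
  by rewrite natrM -r2 lnXn// mulr_natl.
have lnr : ln r <= r by apply/ltW/ln_sublinear.
have c0 : 0 <= c%:R :> R by exact: ler0n.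
have -> : 4 * c%:R / n%:R * (2 * ln r) = 8 * c%:R * ln r / n%:R by field; rewrite gt_eqF.
rewrite ler_pdivrMr//; apply: le_trans (_ : 8 * c%:R * r <= _).
  by rewrite ler_wpM2l// mulr_ge0.
rewrite -ler_sqr ?nnegrE ?mulr_ge0 ?(ltW r0) ?(ltW eps0) ?(ltW n0)//.
rewrite !exprMn r2; move: nC; rewrite /C ler_pdivrMr ?exprn_gt0// => nC.
have := ler_wpM2l (ltW n0) nC; lra.
Qed.

(** * Amenability from a coarsely equivariant injection into the group *)

Section CoarselyEquivariantSections.
Context {R : realType} {G : groupType} (L : groupClosed G).
Context {len : G -> nat} {D : nat}.
Hypothesis hL : hyperbolic_length len D.

Lemma l1_dist_sym (p q : G -> R) : l1_dist p q = l1_dist q p.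
Proof. by apply: eq_esum => g _; rewrite distrC. Qed.

Local Notation Sh l k x z := (fset_set (shadow len l k x z)).

Lemma in_shadow l k x z p : p \in Sh l k x z = (p \in shadow len l k x z).
Proof. exact/in_fset_set/(shadow_finite hL). Qed.

Lemma average_left_translate n l g x z :
  left_translate g (average n (fun k => Sh l k x z) : G -> R) =
  average n (fun k => Sh l k (g * x)%g (g * z)%g).
Proof.
apply/funext => h; rewrite /left_translate /average; congr (_ * _).
apply: eq_bigr => k _; rewrite /unif.
have mE p : (p \in Sh l (n + k) (g * x)%g (g * z)%g) = (g^-1 * p \in Sh l (n + k) x z)%g.
  have [pg gp] := shadow_mull (len := len) l (n + k) g x z p.
  by rewrite !in_shadow; apply/idP/idP; rewrite !inE.
congr (_ / _%:R); first by rewrite mE.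
have -> : Sh l (n + k) (g * x)%g (g * z)%g =
    [fset (g * p)%g | p in Sh l (n + k) x z]%fset.
  apply/fsetP => p; rewrite mE; apply/idP/imfsetP => [gp|[q qS ->]].
    by exists (g^-1 * p)%g => //; rewrite mulVKg.
  by rewrite mulKg.
by rewrite card_imfset//; exact: mulgI.
Qed.

(** The measures average shadows from [1] towards [s u]. Translation by [g] moves the ends to [g]
    and [g * s u], a bounded distance from [1] and from the value of [s] at the translated coset. *)
Lemma amenable_of_coarse_section (s : lcosets_of L -> G) :
  infinite_set [set: lcosets_of L] -> injective s ->
  (forall g, exists c, forall u,
     (ldist len (g * s u)%g (s (lcoset_act g u)) <= c)%N) ->
  topologically_amenable R (boundary_act L).
Proof.
move=> Linf sinj scoarse.
(* Ensures [k + D < l n] up to [k = 3 * n], the largest index in the estimate for averages. *)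
pose l n := (3 * n + D).+1.
(* The minimum keeps shadows nonempty for the finitely many [u] with [s u] short. *)
pose S n u k := Sh (minn (l n) (len (s u))) k 1%g (s u).
have Smono n u : {homo S n u : i j / (i <= j)%N >-> (i `<=` j)%fset}.
  move=> i j ij; rewrite -fset_set_sub; try exact: (shadow_finite hL).
  exact: (shadow_mono hL) ij.
have S0 n u : S n u 0 != fset0.
  have [|p pS] := @shadow_nonempty _ _ _ hL (minn (l n) (len (s u))) 1%g (s u).
    by rewrite ldist1 geq_minr.
  by apply/fset0Pn; exists p; rewrite in_shadow inE.
pose mu n u : G -> R := average n.+1 (S n.+1 u).
have far_cofinite N : cofinite_set [set u | (N < len (s u))%N].
  have sfin : finite_set (s @^-1` [set g | (len g <= N)%N]).
    by apply: finite_preimage; [move=> u v _ _; exact: sinj|exact: hl_finite hL N].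
  by apply: sub_finite_set sfin => u /= /negP; rewrite -leqNgt.
apply: (@amenable_of_asymptotic R G L mu) => //.
- move=> n; pose F := fset_set [set p | (len p <= l n.+1 + 2 * n.+1)%N].
  have FE p : (p \in F) = (len p <= l n.+1 + 2 * n.+1)%N.
    by rewrite in_fset_set; [exact: asboolb|exact: hl_finite hL _].
  (* A measure is determined by [n + 1] subsets of the finite ball [F]. *)
  pose avg (phi : {ffun 'I_n.+1 -> fpowerset F}) (g : G) : R :=
    n.+1%:R^-1 * \sum_(k < n.+1) unif (val (phi k)) g.
  apply: (@sub_finite_set _ _ (range avg)); last exact/finite_image/finite_finset.
  move=> _ [u _ <-].
  have SF (k : 'I_n.+1) : S n.+1 u (n.+1 + k)%N \in fpowerset F.
    rewrite fpowersetE; apply/fsubsetP => p; rewrite in_shadow inE.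
    move=> /(shadow_near hL); rewrite ldist1 FE; have := ltn_ord k.
    have := geq_minl (l n.+1) (len (s u)); lia.
  exists [ffun k => FSetSub (SF k)] => //; apply/funext => g.
  by rewrite /avg /mu /average; congr (_ * _); apply: eq_bigr => k _; rewrite ffunE.
- by move=> n u; exact: average_prob.
move=> g eps eps0; have [c0 c0P] := scoarse g; have [c cE] : exists c, c = (c0 + len g)%N by eexists.
set V := #|` fset_set [set h | (len h <= 3 * D)%N]|.
(* With [m = n + 1], the shadow of index [3 * m] has at most
   [(6 * m + D + 2) * V <= m * ((D + 8) * V)] points. *)
have [|N NP] := @log_average_small R c ((D + 8) * V) eps _ eps0.
  rewrite muln_gt0 addn_gt0 orbT cardfs_gt0; apply/fset0Pn; exists 1%g.
  by rewrite in_fset_set; [rewrite inE /= (hl_one hL)|exact: hl_finite hL _].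
exists (maxn c N) => n; rewrite geq_max => /andP[cn Nn].
have [m mE] : exists m, m = n.+1 by exists n.+1.
have lm : l m = (3 * m + D).+1 by [].
apply: sub_finite_set (far_cofinite (12 * m + 2 * D + l m + c0 + len g)%N); apply: subsetC => u /= uM.
have gM : (l m <= len (s (lcoset_act g u)))%N.
  have := c0P u; have := ldist_triangle hL (s (lcoset_act g u)) 1%g (g * s u)%g.
  rewrite (ldistC hL (s _)) !ldist1.
  have := hl_mul hL g^-1%g (g * s u)%g; rewrite mulKg (hl_inv hL); lia.
have -> : left_translate g (mu n u) = average m (fun k => Sh (l m) k g (g * s u)%g).
  by rewrite /mu -mE average_left_translate mulg1 (minn_idPl _)//; lia.
have -> : mu n (lcoset_act g u) = average m (fun k => Sh (l m) k 1%g (s (lcoset_act g u))).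
  by rewrite /mu -mE /S (minn_idPl _).
rewrite l1_dist_sym.
have gs : ldist len g (g * s u)%g = len (s u).
  by rewrite -{1}[g]mulg1 ldist_mull ldist1.
apply: le_trans (l1_dist_average (c := c) _ _ _ _ _ _) _.
- by rewrite mE.
- by lia.
- move=> i j ij; rewrite -fset_set_sub; try exact: (shadow_finite hL).
  exact: (shadow_mono hL) ij.
- have [|p pS] := @shadow_nonempty _ _ _ hL (l m) g (g * s u)%g.
    by rewrite gs; lia.
  by apply/fset0Pn; exists p; rewrite in_shadow inE.
- move=> k; rewrite -fset_set_sub; try exact: (shadow_finite hL).
  apply: (shadow_move hL); first by rewrite (ldistC hL) ldist1; lia.
  by have := c0P u; lia.
- move=> k; rewrite -fset_set_sub; try exact: (shadow_finite hL).
  apply: (shadow_move hL); first by rewrite ldist1; lia.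
  by have := c0P u; rewrite (ldistC hL); lia.
rewrite lee_fin; apply: le_trans (NP m _); last by lia.
rewrite ler_wpM2l ?divr_ge0 ?mulr_ge0 ?ler0n//.
have card_le : (#|` Sh (l m) (3 * m) g (g * s u)%g| <= m * ((D + 8) * V))%N.
  have := @shadow_card _ _ _ hL (l m) (3 * m)%N g (g * s u)%g.
  rewrite gs -/V => /(_ _ _)/leq_trans; apply; [lia..|].
  by rewrite mulnA leq_mul2r; apply/orP; right; nia.
rewrite ler_ln ?posrE ?ltr0n ?ler_nat//.
  rewrite cardfs_gt0; have [|p pS] := @shadow_nonempty _ _ _ hL (l m) g (g * s u)%g.
    by rewrite gs; lia.
  apply/fset0Pn; exists p; rewrite in_shadow inE.
  exact: (shadow_mono hL) (leq0n _) _ pS.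
apply: leq_trans card_le; rewrite cardfs_gt0.
have [|p pS] := @shadow_nonempty _ _ _ hL (l m) g (g * s u)%g.
  by rewrite gs; lia.
apply/fset0Pn; exists p; rewrite in_shadow inE.
exact: (shadow_mono hL) (leq0n _) _ pS.
Qed.

End CoarselyEquivariantSections.

(** * Quasiconvex subgroups *)

Lemma exists_argmin (T : Type) (P : T -> Prop) (f : T -> nat) :
  (exists x, P x) -> exists2 x, P x & forall y, P y -> (f x <= f y)%N.
Proof.
move=> [x0 Px0].
have ex : exists n, `[< exists2 x, P x & f x = n >].
  by exists (f x0); apply/asboolP; exists x0.
case: (ex_minnP ex) => _ /asboolP[x Px <-] xmin; exists x => // y Py.
by apply: xmin; apply/asboolP; exists y.
Qed.

(** The equation puts [p] on a geodesic from [1] to [h]; for a subgroup, left translation reduces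
    all geodesics between its points to this case. *)
Definition quasiconvex (G : groupType) (len : G -> nat) (A : set G) (kappa : nat) : Prop :=
  forall h p, A h -> (len p + len (p^-1 * h)%g)%N = len h ->
  exists2 h', A h' & (ldist len p h' <= kappa)%N.

Section QuasiconvexSubgroup.
Context {R : realType} {G : groupType} (L : groupClosed G).
Context {len : G -> nat} {D : nat}.
Hypothesis hL : hyperbolic_length len D.

(* The section sends a coset to one of its shortest elements. *)
Lemma amenable_of_quasiconvex (kappa : nat) :
  infinite_set [set: lcosets_of L] -> quasiconvex len [set` L] kappa ->
  topologically_amenable R (boundary_act L).
Proof.
move=> Linf qc.
have /choice[s sP] (u : lcosets_of L) :
    exists x, lcoset_of L x = u /\ forall y, lcoset_of L y = u -> (len x <= len y)%N.
  have [x ux] := lcoset_of_surj u.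
  have [|y yu ymin] := @exists_argmin _ (fun y => lcoset_of L y = u) len.
    by exists x.
  by exists y.
apply: (amenable_of_coarse_section hL (s := s)) => //.
  by move=> u v suv; rewrite -(sP u).1 suv (sP v).1.
move=> g; exists (2 * (2 * len g + kappa + D)).+1%N => u.
move: (s u) (s (lcoset_act g u)) (sP u) (sP (lcoset_act g u)).
move=> x v [xu xmin] [vg vmin].
(* Both [x] and [y] lie in [u]; [x] is shortest there and [y] exceeds it by at most [2 * len g]. *)
have [y yE] : exists y, y = (g^-1 * v)%g by eexists.
have yu : lcoset_of L y = u by rewrite yE -lcoset_actE vg lcoset_actK.
have -> : ldist len (g * x)%g v = ldist len x y.
  by rewrite -(ldist_mull g x y) yE mulVKg.
have ylen : (len y <= 2 * len g + len x)%N.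
  have := vmin (g * x)%g; rewrite -lcoset_actE xu => /(_ erefl) vgx.
  have := hl_mul hL g x; rewrite yE => gx.
  by apply: leq_trans (hl_mul hL _ _) _; rewrite (hl_inv hL); lia.
have xyL : (x^-1 * y)%g \in L by apply/lcoset_ofP; rewrite xu yu.
have ihalf : ((ldist len x y)./2 <= ldist len x y)%N by lia.
(* The midpoint [m] is within [kappa] of an element of [u], so it cannot be much shorter than
   [x]. *)
have [m xm my] := ldist_geodesic hL ihalf.
have [||h hLh mh] := qc (x^-1 * y)%g (x^-1 * m)%g.
- exact: xyL.
- move: xm my; rewrite /ldist invgM invgK -mulgA mulVKg => -> ->.
  exact: subnKC ihalf.
have xlen : (len x <= len m + kappa)%N.
  apply: leq_trans (_ : len (x * h)%g <= _)%N.
    by apply: xmin; rewrite -xu; apply/lcoset_ofP; rewrite invgM mulgVK gpredV.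
  have := ldist_triangle hL m 1%g (x * h)%g; rewrite !ldist1 => mx.
  have : ldist len m (x * h)%g = ldist len (x^-1 * m)%g h.
    by rewrite -(ldist_mull x^-1%g) mulKg.
  lia.
(* If [x] and [y] were far apart, hyperbolicity would make [m] much shorter than [x]. *)
have := ldist_four hL x 1%g y m.
rewrite (ldistC hL x 1%g) (ldistC hL y m) !ldist1; lia.
Qed.

End QuasiconvexSubgroup.

(** * Word lengths *)

Section WordLength.
Context {G : groupType}.
Implicit Types (S w : seq G) (g : G).

Lemma word_value_cat w1 w2 : word_value (w1 ++ w2) = (word_value w1 * word_value w2)%g.
Proof. exact: big_cat. Qed.

Lemma word_value_inv w : word_value (rev (map (fun x => x^-1)%g w)) = (word_value w)^-1%g.
Proof.
elim: w => [|a w IH]; first by rewrite /word_value !big_nil invg1.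
rewrite /= rev_cons -cats1 word_value_cat IH /word_value !big_cons big_nil mulg1.
by rewrite invgM.
Qed.

Lemma word_over_inv S w : word_over S w -> word_over S (rev (map (fun x => x^-1)%g w)).
Proof.
rewrite /word_over all_rev all_map; apply: sub_all => x /=.
by rewrite invgK orbC.
Qed.

Lemma word_length_le S w : word_over S w -> (word_length S (word_value w) <= size w)%N.
Proof.
move=> Sw; rewrite /word_length; case: pselect => // ex.
by case: ex_minnP => n _; apply; apply/asboolP; exists w.
Qed.

Lemma word_length_word S (A : set G) g : generates S A -> A g ->
  exists w, [/\ word_over S w, size w = word_length S g & word_value w = g].
Proof.
move=> -> [w Sw wg]; rewrite /word_length; case: pselect => [ex|[]]; last first.
  by exists (size w); apply/asboolP; exists w.
by case: ex_minnP => n /asboolP[w' [? ? ?]] _; exists w'.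
Qed.

Lemma generates_word S (A : set G) w : generates S A -> word_over S w -> A (word_value w).
Proof. by move=> -> Sw; exists w. Qed.

Lemma subadditive_word_bound S (f : G -> nat) :
  f 1%g = 0%N -> (forall g, f g^-1%g = f g) ->
  (forall g h, (f (g * h)%g <= f g + f h)%N) ->
  exists M, forall w, word_over S w -> (f (word_value w) <= M * size w)%N.
Proof.
move=> f1 fV fM; exists (\max_(x <- S) f x)%N.
elim=> [|a w IH] /=; first by rewrite /word_value big_nil f1.
rewrite /word_over /= => /andP[Sa /IH{}IH].
rewrite /word_value big_cons mulnS; apply: leq_trans (fM _ _) _.
rewrite leq_add//; case/orP: Sa => Sa; first exact: leq_bigmax_seq.
by rewrite -fV; exact: leq_bigmax_seq.
Qed.

Lemma word_length1 S : word_length S 1%g = 0%N.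
Proof.
by have := @word_length_le S [::] isT; rewrite /word_value big_nil leqn0 => /eqP.
Qed.

Section Generating.
Variable S : seq G.
Hypothesis SG : generates S [set: G].

Lemma word_lengthV g : word_length S g^-1%g = word_length S g.
Proof.
have le h : (word_length S h^-1%g <= word_length S h)%N.
  have [//|w [Sw <- <-]] := word_length_word (g := h) SG.
  rewrite -word_value_inv -(size_map (fun x => x^-1)%g w) -size_rev.
  exact/word_length_le/word_over_inv.
by apply/eqP; rewrite eqn_leq le -{1}[g]invgK le.
Qed.

Lemma word_lengthM g h :
  (word_length S (g * h)%g <= word_length S g + word_length S h)%N.
Proof.
have [//|w [Sw <- <-]] := word_length_word (g := g) SG.
have [//|v [Sv <- <-]] := word_length_word (g := h) SG.
rewrite -word_value_cat -size_cat; apply: word_length_le.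
by rewrite /word_over all_cat; apply/andP.
Qed.

(** Cutting a shortest word after [i] letters gives two upper bounds; subadditivity makes them
    equalities. *)
Lemma word_length_geodesic g i : (i <= word_length S g)%N ->
  exists2 p, word_length S p = i & word_length S (p^-1 * g)%g = (word_length S g - i)%N.
Proof.
have [//|w [Sw ws wg]] := word_length_word (g := g) SG.
rewrite -ws => iw.
have gE : g = (word_value (take i w) * word_value (drop i w))%g.
  by rewrite -word_value_cat cat_take_drop.
move: Sw; rewrite -{1}(cat_take_drop i w) /word_over all_cat => /andP[S1 S2].
have l1 := word_length_le S1; have l2 := word_length_le S2.
have l3 := word_lengthM (word_value (take i w)) (word_value (drop i w)).
rewrite -gE -ws in l3; rewrite size_takel// in l1; rewrite size_drop in l2.
exists (word_value (take i w)); first lia.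
by rewrite {1}gE mulKg; lia.
Qed.

Lemma word_length_finite n : finite_set [set g | (word_length S g <= n)%N].
Proof.
pose letters := S ++ map (fun x => x^-1)%g S.
pose B := fix B n := if n is m.+1 then
  B m ++ [seq (a * g)%g | a <- letters, g <- B m] else [:: 1%g].
have BP w : word_over S w -> (size w <= n)%N -> word_value w \in B n.
  elim: w n => [|a w IH] [|k]//=.
  - by rewrite /word_value big_nil inE.
  - move=> _ _; rewrite mem_cat; apply/orP; left.
    by rewrite /word_value big_nil; elim: k => [|k IHk] /=; rewrite ?inE// mem_cat IHk.
  rewrite /word_over /= => /andP[Sa Sw] wk; rewrite mem_cat; apply/orP; right.
  rewrite /word_value big_cons; apply: allpairs_f; last exact: IH.
  rewrite mem_cat; case/orP: Sa => [->//|Sa]; apply/orP; right.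
  by apply/mapP; exists a^-1%g; rewrite ?invgK.
apply: sub_finite_set (finite_seq (B n)) => g /=.
have [//|w [Sw <- <-]] := word_length_word (g := g) SG.
exact: BP.
Qed.

End Generating.

(** Doubled, the Gromov product inequality at base point [o] is the four-point condition with
    constant [2 * delta], here enlarged to a natural number. *)
Lemma hyperbolic_group_length (R : realType) : hyperbolic_group R G ->
  exists S D, generates S [set: G] /\ hyperbolic_length (word_length S) D.
Proof.
move=> [S SG [delta delta0 hyp]].
exists S, (Num.trunc (2 * delta)).+1; split=> //; split.
- exact: word_length1.
- exact: word_lengthV.
- exact: word_lengthM.
- exact: word_length_geodesic.
- exact: word_length_finite.
move=> x y z o; rewrite -(ler_nat R) !(natrD _ _ _).
have tr := truncnS_gt (2 * delta); move: tr.
set t : R := (Num.trunc _).+1%:R => tr.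
have := hyp o x y z; rewrite /gromov_product /word_dist.
set xz : R := (word_length S (x^-1 * z)%g)%:R.
set yo : R := (word_length S (y^-1 * o)%g)%:R.
set xo : R := (word_length S (x^-1 * o)%g)%:R.
set zo : R := (word_length S (z^-1 * o)%g)%:R.
set xy : R := (word_length S (x^-1 * y)%g)%:R.
set yz : R := (word_length S (y^-1 * z)%g)%:R.
have m1 : xy + zo <= (maxn (word_length S (x^-1 * y)%g + word_length S (z^-1 * o)%g)
    (word_length S (y^-1 * z)%g + word_length S (x^-1 * o)%g))%:R.
  by rewrite -natrD ler_nat leq_maxl.
have m2 : yz + xo <= (maxn (word_length S (x^-1 * y)%g + word_length S (z^-1 * o)%g)
    (word_length S (y^-1 * z)%g + word_length S (x^-1 * o)%g))%:R.
  by rewrite -natrD ler_nat leq_maxr.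
rewrite minEle; case: ifP => _; lra.
Qed.

End WordLength.

(** * The Morse lemma *)

Lemma sqr_le_exp2 k : (4 <= k)%N -> (k * k <= 2 ^ k)%N.
Proof.
elim: k => // k IH; rewrite leq_eqVlt => /orP[/eqP <-//|k4].
by have := IH k4; rewrite expnS; nia.
Qed.

(* Pick [k] about [E / (D + 1)]: then [k D] is at most about [E] while [2 ^ k] is
   superlinear in [E]. *)
Lemma exp2_beats_linear (P Q M D : nat) : exists E0, forall E, (E0 <= E)%N ->
  exists k, (P * E + Q <= 2 ^ k)%N /\ (M + (k + 2) * D < 2 * E)%N.
Proof.
pose a := (D.+1 + P * (M + 3 * D.+1) + Q + 4)%N.
exists (M + (P * D.+1 + a + 2).+1 * D.+1)%N => E hE.
pose q := ((E - M) %/ D.+1)%N.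
have qE : (q * D.+1 <= E - M)%N by exact: leq_trunc_div.
have Eq : (E - M < q.+1 * D.+1)%N by exact: ltn_ceil.
have qa : (P * D.+1 + a + 2 < q)%N.
  by rewrite /q leq_divRL//; move: hE; clear; lia.
exists (q - 2)%N; split; last first.
  by rewrite subnK; [move: hE qE; clear; nia|move: qa; clear; lia].
apply: leq_trans (sqr_le_exp2 _); last by move: qa; rewrite /a; clear; lia.
have [k kE] : exists k, q = (k + 2)%N.
  by exists (q - 2)%N; rewrite subnK//; move: qa; clear; lia.
rewrite kE addnK; move: qa Eq; rewrite kE /a; clear => qa Eq.
have h1 : (E <= M + (k + 3) * D.+1)%N by lia.
apply: leq_trans (_ : P * (M + (k + 3) * D.+1) + Q <= _)%N; first by rewrite leq_add2r leq_mul2l h1 orbT.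
have h2 : (P * D.+1 + (P * (M + 3 * D.+1) + Q) <= k)%N by lia.
have h3 : (1 <= k)%N by lia.
have := leq_mul (leqnn k) h2; rewrite !mulnDr.
have : (P * (M + 3 * D.+1) + Q <= k * (P * (M + 3 * D.+1) + Q))%N by rewrite leq_pmull.
lia.
Qed.

Section MorseLemma.
Context {G : groupType} {len : G -> nat} {D : nat}.
Hypothesis hL : hyperbolic_length len D.
Local Open Scope nat_scope.
Local Notation d := (ldist len).

(* Iterated four-point inequality along a chain: bisecting the chain loses one
   additive constant [D] per halving. *)
Lemma chain_four k (x : nat -> G) o m i N : (0 < N <= 2 ^ k) ->
  (forall j, d (x j) (x j.+1) + m <= d (x j) o + d (x j.+1) o) ->
  d (x i) (x (i + N)) + m <= d (x i) o + d (x (i + N)) o + k * D.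
Proof.
elim: k i N => [|k IH] i N /andP[N0 Nk] xm.
  have -> : N = 1 by rewrite expn0 in Nk; lia.
  by have := xm i; rewrite addn1; lia.
have [N1|N1] := leqP N 1.
  have -> : N = 1 by lia.
  by have := xm i; rewrite addn1; lia.
rewrite expnS in Nk.
have hA := IH i N./2 _ xm; have hB := IH (i + N./2) (N - N./2) _ xm.
have hs : i + N./2 + (N - N./2) = i + N by lia.
rewrite hs in hB.
have := ldist_four hL (x i) (x (i + N./2)) (x (i + N)) o.
have := hA ltac:(lia); have := hB ltac:(lia); rewrite mulSn; lia.
Qed.

Variables (A : set G) (S : seq G).
Hypotheses (SA : generates S A) (A1 : A 1%g)
  (AM : forall g h, A g -> A h -> A (g * h)%g) (AV : forall g, A g -> A g^-1%g).

(** Prefixes of a shortest word for [y^-1 * z] give a chain in [A] with steps at most [M], outside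
    the open ball of radius [E] around [p]. *)
Lemma far_chain M k E p y z : A y -> A z ->
  (forall a, a \in S -> len a <= M) ->
  (forall h, A h -> E <= d p h) ->
  word_length S (y^-1 * z)%g <= 2 ^ k ->
  d y z + 2 * E <= d y p + d z p + k * D + M.
Proof.
move=> Ay Az SM Ep.
have [w [Sw <- wv]] := word_length_word SA (AM (AV Ay) Az).
move=> wk; have [w0|w0] := posnP (size w).
  have yz : z = y.
    apply: (@mulgI _ y^-1%g); rewrite mulVg -wv.
    by move: w0 => /size0nil ->; rewrite /word_value big_nil.
  rewrite yz (ldistxx hL); have := Ep y Ay; rewrite (ldistC hL p); lia.
pose x j := (y * word_value (take j w))%g.
have Ax j : A (x j).
  apply: AM => //; apply: (generates_word SA).
  by move: Sw; rewrite -{1}(cat_take_drop j w) /word_over all_cat => /andP[].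
have x0 : x 0 = y by rewrite /x take0 /word_value big_nil mulg1.
have xN : x (size w) = z by rewrite /x take_size wv mulVKg.
have step j : d (x j) (x j.+1) <= M.
  have [jw|jw] := ltnP j (size w); last first.
    by rewrite /x !take_oversize// ?(leq_trans jw)// (ldistxx hL).
  rewrite /x ldist_mull (take_nth 1%g)// -cats1 word_value_cat /ldist mulKg.
  rewrite /word_value big_seq1.
  have := all_nthP 1%g Sw j jw; case/orP => ?; first exact: SM.
  by rewrite -(hl_inv hL); exact: SM.
have := @chain_four k x p (2 * E - M) 0 (size w).
rewrite w0 wk add0n x0 xN => /(_ isT) h.
have : d y z + (2 * E - M) <= d y p + d z p + k * D.
  apply: h => j; have := step j; have := Ep _ (Ax j); have := Ep _ (Ax j.+1).
  have := ldist_triangle hL p (x j) (x j.+1).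
  rewrite (ldistC hL (x j) p) (ldistC hL (x j.+1) p); clear; lia.
lia.
Qed.

(* Morse lemma: if [p] is a point of a geodesic [1, h] at the maximal distance
   [E] from [A], the points of the geodesic at distance [2 E] from [p] are
   joined by a chain through [A] that has linear length in [E] and avoids the
   ball of radius [E] around [p], so [E] is at most logarithmic in [E]. *)
Lemma undistorted_quasiconvex P Q :
  (forall h, A h -> word_length S h <= P * len h + Q) ->
  exists kappa, quasiconvex len A kappa.
Proof.
move=> PQ.
have [M SM] : exists M, forall a, a \in S -> len a <= M.
  by exists (\max_(x <- S) len x) => a aS; exact: leq_bigmax_seq.
(* The slope [P * 6] anticipates the bound [6 * E] on the distance of the points [y'] and [z']
   below. *)
have [E0 E0P] := exp2_beats_linear (P * 6) Q M D.
have /choice[e eP] (p : G) :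
    exists n, (exists2 h, A h & d p h = n) /\ forall h, A h -> n <= d p h.
  have [|h Ah hmin] := @exists_argmin _ A (d p); first by exists 1%g.
  by exists (d p h); split=> //; exists h.
exists E0 => h p Ah ph.
suff : e p <= E0.
  by have [[h' Ah' <-] _] := eP p; exists h'.
(* [I] runs over all geodesics from [1] to [h] at once; [E] below is the maximum over all their
   points. *)
pose I q := len q + len (q^-1 * h)%g = len h.
have ex : exists n, `[< exists2 q, I q & e q = n >].
  by exists (e p); apply/asboolP; exists p.
have bounded n : `[< exists2 q, I q & e q = n >] -> n <= len h.
  move=> /asboolP[q Iq <-]; have := (eP q).2 _ A1.
  by rewrite (ldistC hL) ldist1 //; rewrite /I in Iq; lia.
case: (ex_maxnP ex bounded) => E /asboolP[q Iq eqE] Emax.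
have leE r : I r -> e r <= E by move=> Ir; apply: Emax; apply/asboolP; exists r.
apply: leq_trans (leE p ph) _; rewrite leqNgt; apply/negP => EE0.
have [k [kP kD]] := E0P E (ltnW EE0).
have Eq a : A a -> E <= d q a by rewrite -eqE; exact: (eP q).2.
have Iq' : len q + d q h = len h by [].
(* Go from [q] towards [b] up to distance [2 * E], then to a nearest point of [A]; if [b] comes
   first, stop there. *)
have side b : A b -> (forall y, d b y + d y q = d b q -> I y) ->
    exists y y', [/\ A y', d b y + d y q = d b q, d y q <= 2 * E, d y y' <= E &
      d y y' + 2 * E <= d y q + d y' q].
  move=> Ab bI; have [bq|bq] := leqP (d b q) (2 * E).
    exists b, b; rewrite !(ldistxx hL); split=> //.
    by have := Eq b Ab; rewrite (ldistC hL q); lia.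
  have le : d b q - 2 * E <= d b q by lia.
  have [y by_ yq] := ldist_geodesic hL le.
  have Iy : I y by apply: bI; lia.
  have [[y' Ay' yy'] _] := eP y; exists y, y'.
  have := leE y Iy; rewrite -yy' => y'E.
  by have := Eq y' Ay'; rewrite (ldistC hL q) => h1; split=> //; lia.
have [||y [y' [Ay' yq yqE yy' y4]]] := side 1%g.
- exact: A1.
- move=> y; rewrite !ldist1 => yq.
  have := ldist_triangle hL q y h; have := ldist_triangle hL y 1%g h.
  by rewrite !ldist1 /I -/(d y h); lia.
have [||z [z' [Az' zq zqE zz' z4]]] := side h.
- exact: Ah.
- move=> r; rewrite (ldistC hL h r) (ldistC hL h q) => rq.
  have := ldist_triangle hL q 1%g r; have := ldist_triangle hL r 1%g h.
  by rewrite !ldist1 /I -/(d r h) (ldistC hL q r); lia.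
have yz : d y q + d z q <= d y z.
  move: yq zq; rewrite (ldistC hL h z) (ldistC hL h q) ldist1.
  have := ldist_triangle hL y 1%g h; have := ldist_triangle hL z y h.
  by rewrite !ldist1; lia.
have y'z' : d y' z' <= 6 * E.
  have := ldist_triangle hL y y' z'; have := ldist_triangle hL q y z'.
  have := ldist_triangle hL z q z'.
  by rewrite (ldistC hL y' y) (ldistC hL q z); lia.
have wk : word_length S (y'^-1 * z')%g <= 2 ^ k.
  apply: leq_trans (PQ _ (AM (AV Ay') Az')) _; apply: leq_trans kP.
  by rewrite leq_add2r -mulnA leq_mul2l y'z' orbT.
(* The ends [y'], [z'] of the chain are moved to [y], [z] at cost [2 * D]; as [q] lies between [y]
   and [z], [2 * E <= M + (k + 2) * D] follows, against the choice of [k]. *)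
have f1 := far_chain Ay' Az' SM Eq wk.
have f2 := ldist_four hL y y' z' q; have f3 := ldist_four hL y z' z q.
move: f1 f2 f3 y4 z4 yz kD; rewrite (ldistC hL z z') mulnDl; lia.
Qed.

End MorseLemma.

(** * Undistorted subgroups of hyperbolic groups *)

Section HyperbolicGroups.
Context {R : realType} {G : groupType} (L : groupClosed G).

(** The lower quasi-isometry bound controls the length for [S] by that for [T]; a factor [M] passes
    from [T] to [U], whose word metric is the hyperbolic one. *)
Lemma qi_embedded_quasiconvex (U : seq G) (D : nat) :
  generates U [set: G] -> hyperbolic_length (word_length U) D ->
  qi_embedded_subgroup R L -> exists kappa, quasiconvex (word_length U) [set` L] kappa.
Proof.
move=> UG hU [S [T [SL TG [K [C [K1 C0 qi]]]]]].
have [M MP] := subadditive_word_bound U (word_length1 T) (word_lengthV TG) (word_lengthM TG).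
have K0 : 0 < K by exact: lt_le_trans K1.
apply: (undistorted_quasiconvex hU SL _ _ _
  (P := ((Num.trunc K).+1 * M)%N) (Q := (Num.trunc (K * C)).+1)).
- exact: gpred1.
- by move=> g h; exact: gpredM.
- by move=> g; rewrite /= gpredV.
move=> h Lh; have /andP[+ _] := qi 1%g h gpred1 Lh.
rewrite /word_dist invg1 mul1g => low.
have Th : (word_length T h <= M * word_length U h)%N.
  by have [//|w [Uw <- <-]] := word_length_word (g := h) UG; exact: MP.
rewrite -(ler_nat R) natrD; apply: le_trans (_ : K * (word_length T h)%:R + K * C <= _).
  by rewrite -mulrDr -ler_pdivrMl//; lra.
apply: lerD; last exact/ltW/truncnS_gt.
rewrite -mulnA natrM; apply: ler_pM; rewrite ?ler0n ?(ltW K0)//.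
  exact/ltW/truncnS_gt.
by rewrite ler_nat.
Qed.

Lemma hyperbolic_amenable_boundary :
  hyperbolic_group R G -> qi_embedded_subgroup R L ->
  infinite_set [set: lcosets_of L] -> topologically_amenable R (boundary_act L).
Proof.
move=> /hyperbolic_group_length[U [D [UG hU]]] qi Linf.
have [kappa qc] := qi_embedded_quasiconvex UG hU qi.
exact: (amenable_of_quasiconvex hU Linf qc).
Qed.

End HyperbolicGroups.

(** * Free groups *)

Section FreeGroups.
Context {A : choiceType}.
Implicit Types (u v w : seq (A * bool)) (g h : free_group A).
Local Notation red := (foldr (@reduce_cons A)).

Definition free_length g : nat := size (val g).

Lemma size_reduce u w : (size (red w u) <= size u + size w)%N.
Proof.
elim: u => //= a u; case: (red w u) => [|b s] //=.
by case: ifP => _ /=; lia.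
Qed.

(** Longest common prefix; on reduced words, the Gromov product at the identity. *)
Fixpoint lcp u v : nat :=
  match u, v with
  | a :: u', b :: v' => if a == b then (lcp u' v').+1 else 0
  | _, _ => 0
  end.

Lemma lcp_ultrametric u v w : (minn (lcp u v) (lcp v w) <= lcp u w)%N.
Proof.
elim: u v w => [|a u IH] [|b v] [|c w] //=; rewrite ?minn0 ?min0n//.
case: (eqVneq a b) => [->|ab]; last by rewrite min0n.
by case: eqVneq => _; rewrite ?minn0// minnSS ltnS.
Qed.

Lemma lcp_size_prefix u v : lcp u v = size u -> exists t, v = u ++ t.
Proof.
elim: u v => [|a u IH] [|b v] //=; first by exists [::].
  by exists (b :: v).
by case: eqVneq => // -> [/IH[t ->]]; exists t.
Qed.

Lemma size_inv_word u : size (inv_word u) = size u.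
Proof. by rewrite size_rev size_map. Qed.

(** The common prefix cancels; the first letters after it differ, so nothing else does. *)
Lemma size_reduce_lcp u v : reduced u -> reduced v ->
  (size (red v (inv_word u)) + 2 * lcp u v = size u + size v)%N.
Proof.
elim: u v => [|a u IH] [|b v] ru rv /=; try by lia.
  by rewrite foldr_reduced ?reduced_inv// size_inv_word /=; lia.
have ru' : reduced u := path_sorted ru; have rv' : reduced v := path_sorted rv.
case: (eqVneq a b) => [ab|ab].
  rewrite /inv_word /= rev_cons foldr_rcons /= ab inv_letterK eqxx.
  by have := IH v ru' rv'; rewrite /inv_word; lia.
suff : red (b :: v) (inv_word (a :: u)) = inv_word (a :: u) ++ b :: v.
  by move=> ->; rewrite size_cat size_inv_word /=; lia.
rewrite -{1}(foldr_reduced rv) -foldr_cat foldr_reduced//.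
have := reduced_inv ru; rewrite /inv_word /= rev_cons /reduced => ri.
rewrite cat_rcons sorted_cat_cons ri /= inv_letterK eq_sym ab.
exact: rv.
Qed.

Lemma free_length_lcp g h :
  (free_length (g^-1 * h)%g + 2 * lcp (val g) (val h) = free_length g + free_length h)%N.
Proof. by apply: size_reduce_lcp; exact: valP. Qed.

Lemma free_length_four (x y z : free_group A) :
  (free_length (x^-1 * z)%g + free_length y <=
   maxn (free_length (x^-1 * y)%g + free_length z)
        (free_length (y^-1 * z)%g + free_length x))%N.
Proof.
have := free_length_lcp x z; have := free_length_lcp x y; have := free_length_lcp y z.
have := lcp_ultrametric (val x) (val y) (val z); lia.
Qed.

Lemma free_lengthV g : free_length g^-1%g = free_length g.
Proof. exact: size_inv_word. Qed.

Definition free_eval w : free_group A :=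
  FreeWord (reduced_foldr w (isT : @reduced A [::])).

Lemma free_evalK g : free_eval (val g) = g.
Proof. by apply: val_inj; rewrite /= foldr_reduced//; exact: valP. Qed.

Lemma foldr_reduce u w : reduced w -> red w (red [::] u) = red w u.
Proof.
move=> rw; elim: u => //= a u IH.
by rewrite foldr_reduce_cons// ?IH//; exact: reduced_foldr.
Qed.

Lemma free_eval_cat u v : free_eval (u ++ v) = (free_eval u * free_eval v)%g.
Proof.
by apply: val_inj; rewrite /= foldr_cat foldr_reduce//; exact: reduced_foldr.
Qed.

(** Letters are processed from the right. When a letter cancels the head [c] of the reduced tail,
    the induction applies to the prefix with [c] put back. *)
Lemma prefix_reduce w p t : red [::] w = p ++ t ->
  exists w1 w2, w = w1 ++ w2 /\ red [::] w1 = p.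
Proof.
elim: w p t => [|a w IH] p t /=.
  by case: p => // _; exists [::], [::].
case: p => [_|b p]; first by exists [::], (a :: w).
case rE : (red [::] w) => [|c s] /=.
  case=> <-; case: p => // _; exists [:: a], w; split=> //.
case: ifPn => [/eqP ca|ca].
  move=> sE; have [|w1 [w2 [-> w1E]]] := IH (c :: b :: p) t; first by rewrite rE sE.
  by exists (a :: w1), w2; split=> //=; rewrite w1E /= ca eqxx.
case=> <- cE; have [|w1 [w2 [-> w1E]]] := IH p t; first by rewrite rE cE.
exists (a :: w1), w2; split=> //=; rewrite w1E.
by case: p cE {w1E} => // d p [<- _] /=; rewrite (negPf ca).
Qed.

Lemma free_lengthM g h : (free_length (g * h)%g <= free_length g + free_length h)%N.
Proof. exact: size_reduce. Qed.

(* A prefix of a reduced product is the value of a prefix of the concatenated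
   word, so it is within one factor of the subgroup. *)
Lemma free_finitely_generated_quasiconvex (L : groupClosed (free_group A)) :
  finitely_generated [set` L] -> exists kappa, quasiconvex free_length [set` L] kappa.
Proof.
move=> [S SL]; pose M := (\max_(x <- S) free_length x)%N; exists M.
(* The prefix [t1] ends inside the first factor, where [l = 1] works, or contains it, and the factor
   is absorbed into [l]. *)
have near (w : seq (free_group A)) t1 t2 : word_over S w ->
    flatten [seq val x | x <- w] = t1 ++ t2 ->
    exists2 l, l \in L & (free_length (l^-1 * free_eval t1)%g <= M)%N.
  elim: w t1 t2 => [|a w IH] t1 t2.
    by case: t1 => // _ _; exists 1%g; rewrite ?gpred1.
  rewrite /word_over /= => /andP[Sa Sw] tE.
  have aM : (free_length a <= M)%N.
    case/orP: Sa => Sa; first exact: leq_bigmax_seq.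
    by rewrite -free_lengthV; exact: leq_bigmax_seq.
  have La : a \in L.
    have : word_over S [:: a] by rewrite /word_over /= Sa.
    by move=> /(generates_word SL); rewrite /word_value big_seq1.
  have [le|lt] := leqP (size t1) (size (val a)).
    exists 1%g; first exact: gpred1.
    rewrite invg1 mul1g; apply: leq_trans aM.
    by apply: leq_trans (size_reduce _ _) _; rewrite addn0.
  have t1E : t1 = val a ++ drop (size (val a)) t1.
    rewrite -{1}(cat_take_drop (size (val a)) t1); congr (_ ++ _).
    have := congr1 (take (size (val a))) tE.
    by rewrite take_size_cat// takel_cat// ltnW.
  have [||l Ll lM] := IH (drop (size (val a)) t1) t2; first exact: Sw.
    have := congr1 (drop (size (val a))) tE.
    by rewrite drop_size_cat// {1}t1E -catA drop_size_cat.
  exists (a * l)%g; first exact: gpredM.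
  by rewrite t1E free_eval_cat free_evalK invgM -mulgA mulKg.
move=> h p Lh ph.
(* Geodesics from [1] are prefixes: the equality of lengths forces the common prefix to be all of
   [p]. *)
have [t hE] : exists t, val h = val p ++ t.
  have {}ph : (free_length p + free_length (p^-1 * h)%g = free_length h)%N := ph.
  apply: lcp_size_prefix; have := free_length_lcp p h.
  by rewrite -ph [LHS]addnC addnA => /addIn; rewrite mul2n addnn => /double_inj.
have [w Sw wh] : exists2 w, word_over S w & word_value w = h.
  by rewrite SL in Lh.
have red_flatten : red [::] (flatten [seq val x | x <- w]) = val h.
  rewrite -wh; elim: {Sw wh} w => [|a w IH]; first by rewrite /word_value big_nil.
  by rewrite /word_value big_cons /= foldr_cat IH.
rewrite hE in red_flatten.
have [w1 [w2 [wE w1E]]] := prefix_reduce red_flatten.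
have [l Ll lM] := near w w1 w2 Sw wE.
exists l => //; rewrite /ldist -free_lengthV invgM invgK.
have -> : p = free_eval w1 by apply: val_inj.
exact: lM.
Qed.

End FreeGroups.

Lemma free_hyperbolic_length (A : finType) :
  hyperbolic_length (@free_length A) 0.
Proof.
split=> //.
- exact: free_lengthV.
- exact: free_lengthM.
- move=> g i ig.
  have gE : g = (free_eval (take i (val g)) * free_eval (drop i (val g)))%g.
    by rewrite -free_eval_cat cat_take_drop free_evalK.
  have l1 : (free_length (free_eval (take i (val g))) <= i)%N.
    by apply: leq_trans (size_reduce _ _) _; rewrite addn0 size_takel.
  have l2 : (free_length (free_eval (drop i (val g))) <= free_length g - i)%N.
    by apply: leq_trans (size_reduce _ _) _; rewrite addn0 size_drop.
  have l3 : (free_length g <= free_length (free_eval (take i (val g))) +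
      free_length (free_eval (drop i (val g))))%N.
    by rewrite {1}gE; exact: free_lengthM.
  exists (free_eval (take i (val g))); first lia.
  by rewrite {2}gE mulKg; lia.
- move=> n.
  have fin : finite_set [set w : seq (A * bool) | (size w <= n)%N].
    apply: sub_finite_set (finite_image val (@finite_finset (n.-bseq (A * bool)) setT)).
    by move=> w /= wn; exists (Bseq wn).
  by apply: finite_preimage fin => g h _ _; exact: val_inj.
move=> x y z o.
(* Left translation by [o^-1] moves the base point to [1]. *)
have tr g h : (g^-1 * h = (o^-1 * g)^-1 * (o^-1 * h))%g.
  by rewrite invgM invgK -mulgA mulVKg.
have flip g : free_length (g^-1 * o)%g = free_length (o^-1 * g)%g.
  by rewrite -free_lengthV invgM invgK.
rewrite (flip x) (flip y) (flip z) (tr x z) (tr x y) (tr y z).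
by rewrite addn0; exact: free_length_four.
Qed.

Theorem theorem3p1 (R : realType) :
  (forall (G : groupType) (L : groupClosed G),
     countable [set: G] -> hyperbolic_group R G -> torsion_free G ->
     infinite_set [set` L] -> qi_embedded_subgroup R L ->
     infinite_set [set: lcosets_of L] ->
     topologically_amenable R (boundary_act L))
  /\
  (forall (r : nat) (L : groupClosed (free_group 'I_r)),
     (2 <= r)%N -> finitely_generated [set` L] ->
     infinite_set [set: lcosets_of L] ->
     topologically_amenable R (boundary_act L)).
Proof.
split=> [G L _ Ghyp _ _ Lqi Linf|r L _ /free_finitely_generated_quasiconvex[kappa qc] Linf].
  exact: hyperbolic_amenable_boundary Ghyp Lqi Linf.
exact: (@amenable_of_quasiconvex R _ L _ _ (free_hyperbolic_length 'I_r) kappa Linf qc).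
Qed.
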